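(* Let $\mathcal{P}$ be a finite classical polar space over $\mathbb{F}_q$ of Witt index $d\ge 1$ with parameter $e$, and let $\Gamma(q,d,e)$ be the associated dual polar graph. Then the metric dimension of $\Gamma(q,d,e)$ is at most the rank over $\mathbb{R}$ of the incidence matrix of $\mathcal{P}$; that is, it is at most \[ \frac{(q^{d+e-1}+1)(q^{d+e-1}-q^{e-1}+q-1)}{(q^{e-1}+1)(q-1)}. \]
   Context: Let $V(n,q)$ be an $n$-dimensional vector space over the finite field $\mathbb{F}_q$ equipped with a non-degenerate symplectic, quadratic or Hermitian form. A subspace is totally isotropic if the form (sesquilinear form, or quadratic form in the quadratic case) vanishes identically on it. The (classical) polar space $\mathcal{P}$ is the collection of all totally isotropic subspaces; its Witt index $d$ is the largest dimension of a totally isotropic subspace. Points of $\mathcal{P}$ are the $1$-dimensional totally isotropic subspaces, and generators are the $d$-dimensional totally isotropic subspaces. The parameter $e$ depends on the type: symplectic $Sp(2d,q)$ on $V(2d,q)$: $e=1$; parabolic quadric $\Omega(2d+1,q)$ on $V(2d+1,q)$: $e=1$; hyperbolic quadric $\Omega^+(2d,q)$ on $V(2d,q)$: $e=0$; elliptic quadric $\Omega^-(2d+2,q)$ on $V(2d+2,q)$: $e=2$; Hermitian $U(2d+1,q)$ on $V(2d+1,q)$ ($q$ a square): $e=3/2$; Hermitian $U(2d,q)$ on $V(2d,q)$ ($q$ a square): $e=1/2$. The incidence matrix of $\mathcal{P}$ is the $0/1$ matrix with rows indexed by generators and columns by points, with $(U,x)$-entry $1$ iff $x\subseteq U$. The dual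 polar graph $\Gamma(q,d,e)$ has the generators of $\mathcal{P}$ as vertices, two generators being adjacent iff their intersection has dimension $d-1$. For a finite connected graph, a resolving set is a set $S$ of vertices such that for any two distinct vertices $u,w$ there is $x\in S$ with $d(u,x)\ne d(w,x)$ (graph distance); the metric dimension is the minimum size of a resolving set. *)

(* Defs.v *)
From Stdlib Require Import Reals.
From HB Require Import structures.
From mathcomp Require Import all_boot all_order all_algebra all_field.
From mathcomp Require Import Rstruct.

Set Implicit Arguments.
Unset Strict Implicit.
Unset Printing Implicit Defensive.

Import GRing.Theory.
Local Open Scope ring_scope.

Section PolarSpaces.
Variables (F : finFieldType) (n : nat).
Local Notation V := 'rV[F]_n.

Definition is_subspace (U : {set V}) : bool :=
  (0 \in U) && [forall u in U, forall v in U, forall a : F, a *: u + v \in U].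

Definition sdim (U : {set V}) : nat := \dim <<enum U>>%VS.

Definition sesquilinear (sigma : F -> F) (f : V -> V -> F) : Prop :=
  (forall (a : F) (u v w : V), f (a *: u + v) w = a * f u w + f v w) /\
  (forall (a : F) (u v w : V), f u (a *: v + w) = sigma a * f u v + f u w).

Definition nondegenerate_form (f : V -> V -> F) : Prop :=
  forall u : V, (forall v : V, f u v = 0) -> u = 0.

Definition symplectic_form (f : V -> V -> F) : Prop :=
  [/\ sesquilinear (fun x : F => x) f, (forall v : V, f v v = 0) & nondegenerate_form f].

(* non-degenerate Hermitian form w.r.t. a field automorphism sigma of order 2
   (over F_q this forces q to be a square and sigma x = x ^ sqrt q) *)
Definition hermitian_form (sigma : {rmorphism F -> F}) (f : V -> V -> F) : Prop :=
  [/\ sesquilinear sigma f, (forall u v : V, f v u = sigma (f u v)),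
      (forall x : F, sigma (sigma x) = x), (exists x : F, sigma x != x)
    & nondegenerate_form f].

Definition polar_form (Q : V -> F) (u v : V) : F := Q (u + v) - Q u - Q v.

Definition quadratic_form (Q : V -> F) : Prop :=
  (forall (a : F) (v : V), Q (a *: v) = a ^+ 2 * Q v) /\ sesquilinear (fun x : F => x) (polar_form Q).

Definition nondegenerate_quadratic_form (Q : V -> F) : Prop :=
  quadratic_form Q /\
  (forall v : V, Q v = 0 -> (forall w : V, polar_form Q v w = 0) -> v = 0).

Inductive polar_kind := Symplectic | Quadratic | Hermitian.

Definition classical_form (k : polar_kind) (sigma : {rmorphism F -> F})
  (f : V -> V -> F) (Q : V -> F) : Prop :=
  match k with
  | Symplectic => symplectic_form f
  | Quadratic => nondegenerate_quadratic_form Q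
  | Hermitian => hermitian_form sigma f
  end.

Definition tot_iso (k : polar_kind) (f : V -> V -> F) (Q : V -> F) (U : {set V}) : bool :=
  is_subspace U &&
  match k with
  | Quadratic => [forall u in U, Q u == 0]
  | _ => [forall u in U, forall v in U, f u v == 0]
  end.

Definition witt_index k f Q : nat :=
  \max_(U : {set V} | tot_iso k f Q U) sdim U.

Definition is_point k f Q (U : {set V}) : bool := tot_iso k f Q U && (sdim U == 1%N).
Definition is_generator k f Q (U : {set V}) : bool :=
  tot_iso k f Q U && (sdim U == witt_index k f Q).

Definition generator k f Q := {U : {set V} | is_generator k f Q U}.
Definition point k f Q := {U : {set V} | is_point k f Q U}.

Definition dual_polar_adj k f Q : rel (generator k f Q) :=
  fun U W => (U != W) && (sdim (val U :&: val W) == (witt_index k f Q).-1).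

Definition incidence_matrix k f Q :
  'M[R]_(#|{: generator k f Q}|, #|{: point k f Q}|) :=
  \matrix_(i < #|{: generator k f Q}|, j < #|{: point k f Q}|)
    (if val (enum_val j) \subset val (enum_val i) then 1 else 0).

End PolarSpaces.

Section Metric.
Variables (T : finType) (e : rel T).

Fixpoint gball (x : T) (k : nat) : {set T} :=
  match k with
  | 0 => [set x]
  | k'.+1 => gball x k' :|: [set y | [exists z in gball x k', e z y]]
  end.

(* graph distance (for a connected graph every distance is < #|T|) *)
Definition gdist (x y : T) : nat := find (fun k => y \in gball x k) (iota 0 #|T|).

Definition resolving (S : {set T}) : bool :=
  [forall u, forall w, (u != w) ==> [exists x in S, gdist u x != gdist w x]].

Definition metric_dim : nat := \big[minn/#|T|]_(S : {set T} | resolving S) #|S|.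

End Metric.

Local Open Scope R_scope.
(* parameter e (as a real number): symplectic e = 1; quadratic n = 2d + e;
   Hermitian n = 2d + e - 1/2 *)
Definition polar_e (n : nat) (k : polar_kind) (d : nat) : R :=
  match k with
  | Symplectic => 1
  | Quadratic => INR (n - 2 * d)
  | Hermitian => (INR (n - 2 * d) + / 2)
  end.


Definition polar_bound (q d : nat) (e : R) : R :=
  ((Rpower (INR q) (INR d + e - 1) + 1) *
   (Rpower (INR q) (INR d + e - 1) - Rpower (INR q) (e - 1) + INR q - 1) /
   ((Rpower (INR q) (e - 1) + 1) * (INR q - 1))).

Arguments dual_polar_adj {F n} k f Q.
Arguments incidence_matrix {F n} k f Q.
Arguments witt_index {F n} k f Q.

(* Main.v *)
(* Let M be the incidence matrix. The (U, W) entry of M M^T is the number of points of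
   U :&: W, hence a function of the distance d - dim (U :&: W) of the dual polar graph. If
   generators S index a row basis of M M^T, then the distances to S determine a whole row of
   M M^T, whose diagonal entry singles out its generator; so S is resolving and has size at
   most rank M.

   For the closed formula, let B be the collinearity matrix of the points (with ones on the
   diagonal). Counting points of U :&: x^perp gives M B = q^(d-1) M + c J, and counting common
   perps of two points makes B strongly regular. So, up to a multiple of J, the rows of M are
   fixed by the projection E onto the eigenspace of q^(d-1), and rank M <= 1 + tr E. All
   point counts come from one principle: if T is a totally isotropic subspace of W, then
   outside T^perp a constant proportion 1/q0 of the vectors of W is isotropic, while inside
   U^perp only the vectors of a generator U are. *)
Require Import Defs.
From Stdlib Require Import Reals.
From HB Require Import structures.
From mathcomp Require Import all_boot all_order all_algebra all_field.
From mathcomp Require Import Rstruct.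
From mathcomp Require Import zify ring lra.

Set Implicit Arguments.
Unset Strict Implicit.
Unset Printing Implicit Defensive.

Import Order.TTheory GRing.Theory Num.Theory.
Local Open Scope ring_scope.

(** * Subspaces as finite sets *)

Section Subspaces.
Variables (F : finFieldType) (n : nat).
Local Notation V := 'rV[F]_n.
Local Notation q := #|F|.
Implicit Types (A B C U W T : {set V}) (u v w x y : V).

Lemma is_subspaceP U :
  reflect (0 \in U /\ forall a u v, u \in U -> v \in U -> a *: u + v \in U)
          (is_subspace U).
Proof.
apply: (iffP andP) => -[U0 HU]; split=> //.
- move=> a u v uU vU; move/forallP/(_ u)/implyP/(_ uU): HU.
  by move/forallP/(_ v)/implyP/(_ vU)/forallP/(_ a).
- apply/forallP=> u; apply/implyP=> uU; apply/forallP=> v; apply/implyP=> vU.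
  by apply/forallP=> a; apply: HU.
Qed.

Lemma subspace0 U : is_subspace U -> 0 \in U.
Proof. by case/is_subspaceP. Qed.

Lemma subspaceZD U a u v : is_subspace U -> u \in U -> v \in U -> a *: u + v \in U.
Proof. by case/is_subspaceP=> _; apply. Qed.

Lemma subspaceZ U a u : is_subspace U -> u \in U -> a *: u \in U.
Proof. by move=> sU uU; rewrite -[_ *: _]addr0 subspaceZD ?subspace0. Qed.

Lemma subspaceD U u v : is_subspace U -> u \in U -> v \in U -> u + v \in U.
Proof. by move=> sU; rewrite -{2}[u]scale1r; apply: subspaceZD. Qed.

Lemma subspaceN U u : is_subspace U -> u \in U -> - u \in U.
Proof. by move=> sU uU; rewrite -scaleN1r subspaceZ. Qed.

Lemma subspaceDr U u v : is_subspace U -> u \in U -> (v + u \in U) = (v \in U).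
Proof.
move=> sU uU; apply/idP/idP=> [vuU|vU]; last exact: subspaceD.
by rewrite -[v](addrK u) subspaceD // subspaceN.
Qed.

Lemma subspace_scale U a u : is_subspace U -> a != 0 -> (a *: u \in U) = (u \in U).
Proof.
move=> sU a0; apply/idP/idP=> [auU|]; last exact: subspaceZ.
by rewrite -[u]scale1r -(mulVf a0) -scalerA subspaceZ.
Qed.

Lemma subspaceI U W : is_subspace U -> is_subspace W -> is_subspace (U :&: W).
Proof.
move=> sU sW; apply/is_subspaceP; split=> [|a u v].
  by rewrite inE !subspace0.
by rewrite !inE => /andP[uU uW] /andP[vU vW]; rewrite !subspaceZD.
Qed.

Lemma subspaceT : is_subspace [set: V].
Proof. by apply/is_subspaceP; split=> *; rewrite inE. Qed.

Lemma card_scalars_gt1 : (1 < q)%N.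
Proof. exact: card_finNzRing_gt1. Qed.

Lemma card_subspace U : is_subspace U -> #|U| = (q ^ sdim U)%N.
Proof.
move=> sU; rewrite /sdim -card_vspace; apply: eq_card => v.
apply/idP/idP=> [vU|]; first by rewrite memv_span // mem_enum.
move=> /coord_span ->.
apply: (big_ind (fun v => v \in U)) => [|? ? ? ?|i _]; first exact: subspace0.
  exact: subspaceD.
by apply: subspaceZ => //; rewrite -mem_enum mem_nth // size_tuple.
Qed.

Lemma sdim_leP U k : is_subspace U -> (sdim U <= k)%N = (#|U| <= q ^ k)%N.
Proof. by move=> sU; rewrite card_subspace // leq_exp2l ?card_scalars_gt1. Qed.

Lemma sdim_eqP U k : is_subspace U -> (sdim U == k) = (#|U| == q ^ k)%N.
Proof. by move=> sU; rewrite card_subspace // eqn_exp2l ?card_scalars_gt1. Qed.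

(* All fibres of an additive map on U are translates of its kernel. *)
Lemma card_fiber (phi : V -> F) U (I : {set F}) c :
  is_subspace U -> {morph phi : u v / u + v} ->
  (forall u, u \in U -> phi u \in I) ->
  (forall b, b \in I -> exists2 u, u \in U & phi u = b) ->
  c \in I -> (#|I| * #|[set u in U | phi u == c]|)%N = #|U|.
Proof.
move=> sU phiD im_phi surj cI.
have phi_fiber b : b \in I -> #|[set u in U | phi u == b]| = #|[set u in U | phi u == c]|.
  move=> bI; have [u0 u0U eq0] := surj b bI; have [u1 u1U eq1] := surj c cI.
  rewrite -(card_imset _ (addIr (u1 - u0))); apply: eq_card => v.
  have sub : u1 - u0 \in U by rewrite subspaceD ?subspaceN.
  have phi0 : phi 0 = 0 by apply: (addrI (phi 0)); rewrite -phiD !addr0.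
  have phiN w : phi (- w) = - phi w.
    by apply: (addrI (phi w)); rewrite -phiD !subrr.
  apply/imsetP/idP=> [[w] |].
    rewrite !inE => /andP[wU /eqP phiw] ->.
    by rewrite subspaceDr // wU !phiD phiN phiw eq0 eq1 addrC subrK /=.
  rewrite !inE => /andP[vU /eqP phiv]; exists (v - (u1 - u0)); last by rewrite subrK.
  rewrite inE subspaceDr ?subspaceN // vU !phiD phiN phiD phiN phiv eq0 eq1 /=.
  by rewrite opprB addrC subrK.
rewrite -(sum1_card (mem U)) (partition_big phi (mem I)) //=.
transitivity (\sum_(b in I) #|[set u in U | phi u == c]|)%N.
  by rewrite sum_nat_const.
apply: eq_bigr => b bI; rewrite -(phi_fiber b bI) -sum1_card.
by apply: eq_bigl => u; rewrite inE.
Qed.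

(** Scaling [u0] makes [phi] take every value of the field on [U], so all q fibres have the same
    size. *)
Lemma card_level (phi : V -> F) U u0 c :
  is_subspace U -> (forall a u v, phi (a *: u + v) = a * phi u + phi v) ->
  u0 \in U -> phi u0 != 0 -> (q * #|[set u in U | phi u == c]|)%N = #|U|.
Proof.
move=> sU phi_lin u0U nz; rewrite -cardsT.
have phiD : {morph phi : u v / u + v}.
  by move=> u v; rewrite -{1}[u]scale1r phi_lin mul1r.
have phi0 : phi 0 = 0 by apply: (addrI (phi 0)); rewrite -phiD !addr0.
apply: card_fiber => [//|//|u _|b _|]; rewrite ?inE //.
exists ((b / phi u0) *: u0); first exact: subspaceZ.
by rewrite -[_ *: _]addr0 phi_lin phi0 addr0 divfK.
Qed.

(** Half of the dimension formula: addition maps A x B into C, and each of its fibres injects into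
    the intersection. *)
Lemma leq_card_subspaceI A B C :
  is_subspace A -> is_subspace B -> is_subspace C -> A \subset C -> B \subset C ->
  (#|A| * #|B| <= #|C| * #|A :&: B|)%N.
Proof.
move=> sA sB sC /subsetP AC /subsetP BC; rewrite -cardsX.
rewrite -(sum1_card (mem (setX A B))).
rewrite (partition_big (fun p : V * V => p.1 + p.2) (mem C)) /=; last first.
  by move=> [a b] /setXP[/AC aC /BC bC]; apply: subspaceD.
rewrite -sum_nat_const; apply: leq_sum => c cC.
case: (pickP (fun p => (p \in setX A B) && (p.1 + p.2 == c))) => [[a0 b0]|none]; last first.
  by rewrite big_pred0.
case/andP=> /setXP[/= a0A b0B] /eqP eqc.
(* With a base pair (a0, b0) in the fibre, a - a0 = b0 - b lies in both A and B. *)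
rewrite sum1_card -(card_in_imset (f := fun p : V * V => p.1 - a0)); last first.
  move=> [a b] [a' b'] /andP[_ /eqP /= e1] /andP[_ /eqP /= e2] /addIr eq_a.
  by move: e1; rewrite -e2 eq_a => /addrI ->.
apply/subset_leq_card/subsetP=> _ /imsetP[[a b] /andP[/setXP[aA bB] /eqP /= e] ->].
rewrite inE subspaceD ?subspaceN //=.
have -> : a - a0 = b0 - b.
  by apply/eqP; rewrite subr_eq addrAC eq_sym subr_eq addrC e -eqc addrC.
by rewrite subspaceD ?subspaceN.
Qed.

Definition span_add x U : {set V} := [set p.1 *: x + p.2 | p in setX [set: F] U].

Lemma span_addP x U v :
  reflect (exists a, exists2 u, u \in U & v = a *: x + u) (v \in span_add x U).
Proof.
apply: (iffP imsetP) => [[[a u] /setXP[/= _ uU] ->]|[a [u uU ->]]]; first by exists a, u.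
by exists (a, u) => //; apply/setXP; rewrite inE.
Qed.

Lemma subspace_span_add x U : is_subspace U -> is_subspace (span_add x U).
Proof.
move=> sU; apply/is_subspaceP; split=> [|a u v].
  by apply/span_addP; exists 0, 0; rewrite ?subspace0 // scale0r addr0.
case/span_addP=> b [u' u'U ->] /span_addP[c [v' v'U ->]].
apply/span_addP; exists (a * b + c), (a *: u' + v'); first exact: subspaceZD.
by rewrite scalerDl scalerDr scalerA addrACA.
Qed.

Lemma span_add_r x U : U \subset span_add x U.
Proof.
by apply/subsetP=> u uU; apply/span_addP; exists 0, u; rewrite // scale0r add0r.
Qed.

Lemma span_add_l x U : is_subspace U -> x \in span_add x U.
Proof.
by move=> sU; apply/span_addP; exists 1, 0; rewrite ?subspace0 // scale1r addr0.
Qed.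

Lemma span_add_sub x U W :
  is_subspace W -> x \in W -> U \subset W -> span_add x U \subset W.
Proof.
move=> sW xW /subsetP UW; apply/subsetP=> _ /span_addP[a [u /UW uW ->]].
exact: subspaceZD.
Qed.

Lemma scale_in_eq0 x U a : is_subspace U -> x \notin U -> a *: x \in U -> a = 0.
Proof. by move=> sU xU; have [//|a0] := eqVneq a 0; rewrite subspace_scale // (negPf xU). Qed.

Lemma card_span_add x U : is_subspace U -> x \notin U -> #|span_add x U| = (q * #|U|)%N.
Proof.
move=> sU xU; rewrite -cardsT -cardsX card_in_imset //.
move=> [a u] [b v] /setXP[/= _ uU] /setXP[/= _ vU] e.
have /(scale_in_eq0 sU xU)/eqP : (a - b) *: x \in U.
  suff -> : (a - b) *: x = v - u by rewrite subspaceD ?subspaceN.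
  by apply/eqP; rewrite scalerBl subr_eq addrAC eq_sym subr_eq addrC -e addrC.
by rewrite subr_eq0 => /eqP ab; move: e; rewrite ab => /addrI ->.
Qed.

Lemma span_addI x U W : is_subspace W -> x \notin W -> U \subset W -> span_add x U :&: W = U.
Proof.
move=> sW xW UW; apply/setP=> v; rewrite inE; apply/andP/idP=> [[]|vU]; last first.
  by rewrite (subsetP UW) // (subsetP (span_add_r x U)).
case/span_addP=> a [u uU ->] inW; have uW := subsetP UW u uU.
move: inW; rewrite subspaceDr // => /(scale_in_eq0 sW xW) ->.
by rewrite scale0r add0r.
Qed.

Definition line x : {set V} := [set a *: x | a in [set: F]].

Lemma mem_line x : x \in line x.
Proof. by apply/imsetP; exists 1; rewrite ?inE ?scale1r. Qed.

Lemma lineP x v : reflect (exists a, v = a *: x) (v \in line x).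
Proof. by apply: (iffP imsetP) => [[a _ ->]|[a ->]]; exists a; rewrite ?inE. Qed.

Lemma subspace_line x : is_subspace (line x).
Proof.
apply/is_subspaceP; split=> [|a u v]; first by apply/lineP; exists 0; rewrite scale0r.
move=> /lineP[b ->] /lineP[c ->]; apply/lineP; exists (a * b + c).
by rewrite scalerDl scalerA.
Qed.

Lemma line_sub x U : is_subspace U -> (line x \subset U) = (x \in U).
Proof.
move=> sU; apply/subsetP/idP=> [->|xU _ /lineP[a ->]]; rewrite ?mem_line //.
exact: subspaceZ.
Qed.

Lemma scaler_inj x (a b : F) : x != 0 -> a *: x = b *: x -> a = b.
Proof.
move=> x0 /eqP; rewrite -subr_eq0 -scalerBl scaler_eq0 (negPf x0) orbF subr_eq0.
by move/eqP.
Qed.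

Lemma card_line x : x != 0 -> #|line x| = q.
Proof.
by move=> x0; rewrite card_imset ?cardsT // => a b; apply: scaler_inj.
Qed.

End Subspaces.

(** * Counting isotropic vectors *)

Section IsotropicCounts.
Variables (F : finFieldType) (n : nat).
Local Notation V := 'rV[F]_n.
Local Notation q := #|F|.
Variables (g : V -> V -> F) (iso : pred V) (q0 : nat).
Implicit Types (T U W : {set V}) (u v w x y : V).

(** Both conditions are kept so that one predicate serves all families: [iso] is vacuous for
    symplectic forms, and in characteristic 2 a vanishing polar form does not make Q vanish. *)
Definition tot_iso_for T :=
  [&& is_subspace T, [forall u in T, iso u]
    & [forall u in T, forall v in T, g u v == 0]].

(* Here iso v means that the line of v is totally isotropic; q0 is 1, q or sqrt q in the
   symplectic, quadratic or Hermitian case. *)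
Record polar_axioms : Prop := PolarAxioms {
  polar_lin : forall a u v w, g (a *: u + v) w = a * g u w + g v w;
  polar_refl : forall u v, g u v = 0 -> g v u = 0;
  polar_iso0 : iso 0;
  polar_isoZ : forall a v, iso v -> iso (a *: v);
  polar_isoD : forall u v, iso u -> iso v -> g u v = 0 -> iso (u + v);
  polar_self : forall u, iso u -> g u u = 0;
  polar_nondeg : forall v, iso v -> (forall w, g w v = 0) -> v = 0;
  polar_coset : forall T v u, tot_iso_for T -> u \in T -> g u v != 0 ->
    (q0 * #|[set t in T | iso (v + t)%R]|)%N = #|T| }.

Hypothesis gP : polar_axioms.

Lemma polarD u v w : g (u + v) w = g u w + g v w.
Proof. by rewrite -{1}[u]scale1r (polar_lin gP) mul1r. Qed.

Lemma polar0 w : g 0 w = 0.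
Proof. by apply: (addrI (g 0 w)); rewrite -polarD !addr0. Qed.

Lemma polarZ a u w : g (a *: u) w = a * g u w.
Proof. by rewrite -[_ *: _]addr0 (polar_lin gP) polar0 addr0. Qed.

Lemma polar_sym u v : (g u v == 0) = (g v u == 0).
Proof. by apply/eqP/eqP; apply: (polar_refl gP). Qed.

Lemma polar_r0 w : g w 0 = 0.
Proof. exact: (polar_refl gP (polar0 w)). Qed.

Lemma polar_r_lin0 a u v w : g w u = 0 -> g w v = 0 -> g w (a *: u + v) = 0.
Proof.
move=> /(polar_refl gP) wu /(polar_refl gP) wv; apply: (polar_refl gP).
by rewrite (polar_lin gP) wu wv mulr0 addr0.
Qed.

Lemma tiP T :
  reflect [/\ is_subspace T, forall u, u \in T -> iso u
            & forall u v, u \in T -> v \in T -> g u v = 0] (tot_iso_for T).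
Proof.
apply: (iffP and3P) => -[sT isoT gT]; split=> //.
- by move=> u uT; move/forall_inP: isoT; apply.
- by move=> u v uT vT; move/forall_inP/(_ u uT)/forall_inP/(_ v vT)/eqP: gT.
- exact/forall_inP.
- by apply/forall_inP=> u uT; apply/forall_inP=> v vT; apply/eqP/gT.
Qed.

Lemma ti_subspace T : tot_iso_for T -> is_subspace T.
Proof. by case/tiP. Qed.

Lemma ti_sub T U : tot_iso_for U -> is_subspace T -> T \subset U -> tot_iso_for T.
Proof.
case/tiP=> _ isoU gU sT /subsetP TU; apply/tiP; split=> // [u /TU /isoU //|u v uT vT].
by rewrite gU ?TU.
Qed.

Lemma ti_span_add x T :
  tot_iso_for T -> iso x -> (forall u, u \in T -> g u x = 0) ->
  tot_iso_for (span_add x T).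
Proof.
case/tiP=> sT isoT gT isox gTx; apply/tiP; split; first exact: subspace_span_add.
- move=> _ /span_addP[a [u uT ->]].
  apply: (polar_isoD gP); [exact: (polar_isoZ gP)|exact: isoT|rewrite polarZ].
  by rewrite (polar_refl gP (gTx u uT)) mulr0.
- move=> _ _ /span_addP[a [u uT ->]] /span_addP[b [v vT ->]].
  have gxv := polar_refl gP (gTx v vT).
  apply: polar_r_lin0; rewrite (polar_lin gP).
    by rewrite (polar_self gP) // gTx // mulr0 addr0.
  by rewrite gxv gT // mulr0 addr0.
Qed.

Lemma ti_line x : iso x -> tot_iso_for (line x).
Proof.
move=> isox; apply/tiP; split; first exact: subspace_line.
  by move=> _ /lineP[a ->]; apply: (polar_isoZ gP).
move=> _ _ /lineP[a ->] /lineP[b ->]; rewrite polarZ -[b *: x]addr0.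
by rewrite polar_r_lin0 ?mulr0 ?polar_r0 // (polar_self gP).
Qed.

Definition perp x := [set v | g v x == 0].
Definition orth T := [set v | [forall u in T, g v u == 0]].

Lemma orthP T v : reflect (forall u, u \in T -> g v u = 0) (v \in orth T).
Proof. by rewrite inE; apply: (iffP forall_inP) => h u /h /eqP. Qed.

Lemma subspace_perp x : is_subspace (perp x).
Proof.
apply/is_subspaceP; split=> [|a u v]; rewrite !inE ?polar0 // => /eqP ux /eqP vx.
by rewrite (polar_lin gP) ux vx mulr0 addr0.
Qed.

Lemma subspace_orth T : is_subspace (orth T).
Proof.
apply/is_subspaceP; split=> [|a u v /orthP uT /orthP vT].
  by apply/orthP=> u _; rewrite polar0.
by apply/orthP=> w wT; rewrite (polar_lin gP) uT ?vT // mulr0 addr0.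
Qed.

Lemma ti_sub_orth T : tot_iso_for T -> T \subset orth T.
Proof. by case/tiP=> _ _ gT; apply/subsetP=> u uT; apply/orthP=> v vT; apply: gT. Qed.

Lemma orth_sub_perp T x : x \in T -> orth T \subset perp x.
Proof. by move=> xT; apply/subsetP=> v /orthP/(_ x xT) vx; rewrite inE vx. Qed.

Lemma orthS T U : T \subset U -> orth U \subset orth T.
Proof. by move=> /subsetP TU; apply/subsetP=> v /orthP vU; apply/orthP=> u /TU /vU. Qed.

Lemma card_perpI W w x :
  is_subspace W -> w \in W -> g w x != 0 -> #|W| = (q * #|W :&: perp x|)%N.
Proof.
move=> sW wW wx; rewrite -(card_level (phi := g^~ x) 0 sW _ wW wx).
  by congr (_ * _)%N; apply: eq_card => v; rewrite !inE.
by move=> a u v; rewrite (polar_lin gP).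
Qed.

(** The polar form of a parabolic quadric in characteristic 2 has a radical, but no nonzero
    isotropic vector lies in it; so the perp of a point is always a hyperplane. *)
Lemma iso_not_radical x : iso x -> x != 0 -> exists w, g w x != 0.
Proof.
move=> isox x0; apply/existsP; apply: contraNT x0; rewrite negb_exists => /forallP h.
by apply/eqP/(polar_nondeg gP) => // w; apply/eqP; rewrite -[_ == 0]negbK h.
Qed.

Lemma card_perp x : iso x -> x != 0 -> (q * #|perp x|)%N = #|[set: V]|.
Proof.
move=> isox x0; have [w wx] := iso_not_radical isox x0.
by rewrite (card_perpI (subspaceT F n) _ wx) ?inE // setTI.
Qed.

(* Count the orthogonal pairs in V x T in two ways. *)
Lemma card_orth T : tot_iso_for T -> #|[set: V]| = (#|orth T| * #|T|)%N.
Proof.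
move=> tiT; have [sT isoT _] := tiP T tiT.
have q1 : (1 < q)%N := card_scalars_gt1 F.
set m := #|[set: V]|.
(* The zero vector of T is orthogonal to all m vectors, each other one to m / q of them. *)
have byT : (q * \sum_(u in T) \sum_(v in [set: V]) (g v u == 0%R) = q * m + (#|T| - 1) * m)%N.
  rewrite (bigD1 0) ?subspace0 //= mulnDr; congr (_ + _)%N.
    by congr (_ * _)%N; rewrite /m -sum1_card; apply: eq_bigr => v _; rewrite polar_r0 eqxx.
  rewrite big_distrr /= (eq_bigr (fun => m)) => [|u /andP[uT u0]].
    rewrite sum_nat_const; congr (_ * _)%N.
    rewrite (cardD1 0 (mem T)) subspace0 // add1n subn1 /=.
    by apply: eq_card => u; rewrite !inE andbC.
  rewrite /m -(card_perp (isoT u uT) u0) -sum1_card; congr (_ * _)%N.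
  by rewrite [RHS]big_mkcond [LHS]big_mkcond; apply: eq_bigr => v _; rewrite !inE; case: eqP.
(* A vector of [orth T] is orthogonal to all of T, any other to a hyperplane of T. *)
have byV : (q * \sum_(u in T) \sum_(v in [set: V]) (g v u == 0%R)
            = #|orth T| * (q * #|T|) + (m - #|orth T|) * #|T|)%N.
  rewrite exchange_big big_distrr /= (bigID (mem (orth T))) /=; congr (_ + _)%N.
    rewrite (eq_bigr (fun => q * #|T|)%N) => [|v /andP[_ /orthP vT]].
      by rewrite sum_nat_const; congr (_ * _)%N; apply: eq_card => v; rewrite unfold_in in_setT.
    by rewrite -sum1_card; congr (_ * _)%N; apply: eq_bigr => u uT; rewrite vT // eqxx.
  rewrite (eq_bigr (fun => #|T|)) => [|v /andP[_ vT]].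
    rewrite sum_nat_const /m cardsT -(cardsC (orth T)) addKn; congr (_ * _)%N.
    by apply: eq_card => v; rewrite unfold_in in_setT !in_setC.
  have [u uT uv] : exists2 u, u \in T & g u v != 0.
    move: vT; rewrite inE negb_forall => /existsP[u]; rewrite negb_imply => /andP[uT].
    by rewrite polar_sym; exists u.
  rewrite (card_perpI sT uT uv); congr (_ * _)%N.
  rewrite -sum1_card [LHS]big_mkcond [RHS]big_mkcond /=; apply: eq_bigr => w _.
  by rewrite !inE polar_sym; case: (w \in T); case: eqP.
have T1 : (0 < #|T|)%N by apply/card_gt0P; exists 0; apply: subspace0.
have le : (#|orth T| <= m)%N by apply/subset_leq_card/subsetP => ?; rewrite inE.
move: T1 le q1 (etrans (esym byT) byV); clear; clearbody m.
move: #|orth T| #|T| #|F| => o t r t1 om r1 e.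
apply/eqP; rewrite -(eqn_pmul2l (m := r.-1)); [apply/eqP|]; nia.
Qed.

Definition iso_in W := [set w in W | iso w].

(* Outside the orthogonal of T, exactly one vector in q0 of each coset of T is isotropic. *)
Lemma card_iso_in W T :
  is_subspace W -> tot_iso_for T -> T \subset W ->
  (q0 * #|iso_in W| + #|W :&: orth T| = q0 * #|iso_in (W :&: orth T)| + #|W|)%N.
Proof.
move=> sW tiT TW; have [sT isoT gT] := tiP T tiT.
have outside : (q0 * #|iso_in (W :\: orth T)| = #|W :\: orth T|)%N.
  have T1 : (0 < #|T|)%N by apply/card_gt0P; exists 0; apply: subspace0.
  apply/eqP; rewrite -(eqn_pmul2r T1); apply/eqP.
  have cosets : (\sum_(w in W :\: orth T) (q0 * \sum_(t in T) iso (w + t)%R) =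
                 #|W :\: orth T| * #|T|)%N.
    rewrite -sum_nat_const; apply: eq_bigr => w; rewrite inE => /andP[wT wW].
    have [u uT uw] : exists2 u, u \in T & g u w != 0.
      move: wT; rewrite inE negb_forall => /existsP[u]; rewrite negb_imply => /andP[uT].
      by rewrite polar_sym; exists u.
    rewrite -(polar_coset gP tiT uT uw); congr (_ * _)%N.
    rewrite -sum1_card [LHS]big_mkcond [RHS]big_mkcond /=; apply: eq_bigr => v _.
    by rewrite !inE; case: (v \in T); case: iso.
  rewrite -cosets -big_distrr exchange_big /= -mulnA; congr (_ * _)%N.
  rewrite mulnC -sum_nat_const; apply: eq_bigr => t tT.
  (* Translation by t permutes both W and [orth T], so each t contributes the same number of
     isotropic vectors. *)
  rewrite (reindex_inj (addIr (- t))) /= -sum1_card [LHS]big_mkcond [RHS]big_mkcond /=.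
  apply: eq_bigr => w _; rewrite subrK !in_set.
  have tW := subsetP TW t tT; have tO := subsetP (ti_sub_orth tiT) t tT.
  have -> : (w - t \in W) = (w \in W) by rewrite subspaceDr ?subspaceN.
  have -> : [forall u in T, g (w - t) u == 0] = (w - t \in orth T) by rewrite [RHS]in_set.
  rewrite subspaceDr ?subspaceN ?subspace_orth // in_set.
  by case: [forall u in T, _]; case: (w \in W); case: iso.
have split_iso : #|iso_in W| = (#|iso_in (W :&: orth T)| + #|iso_in (W :\: orth T)|)%N.
  rewrite -(cardsID (orth T) (iso_in W)); congr (_ + _)%N; apply: eq_card => v;
  by rewrite !in_set; case: (v \in W); case: iso; rewrite ?andbF ?andbT.
by rewrite -(cardsID (orth T) W) split_iso mulnDr outside -addnA [(#|_| + _)%N]addnC.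
Qed.
End IsotropicCounts.

(** * Generators: maximality, exchange, and isotropic vectors in perps of one or two points *)

Section Generators.
Variables (F : finFieldType) (n : nat).
Local Notation V := 'rV[F]_n.
Local Notation q := #|F|.
Variables (g : V -> V -> F) (iso : pred V) (q0 d : nat).
Implicit Types (T U W : {set V}) (u v w x y : V).
Hypothesis gP : polar_axioms g iso q0.
Local Notation ti := (tot_iso_for g iso).
Local Notation perp := (perp g).
Local Notation orth := (orth g).
Local Notation iso_in := (iso_in iso).

Definition gen U := ti U && (#|U| == q ^ d)%N.

Hypothesis d_gt0 : (0 < d)%N.
Hypothesis ti_max : forall T, ti T -> (#|T| <= q ^ d)%N.
Hypothesis gen_ex : exists U, gen U.

Lemma gen_ti U : gen U -> ti U. Proof. by case/andP. Qed.
Lemma card_gen U : gen U -> #|U| = (q ^ d)%N. Proof. by case/andP=> _ /eqP. Qed.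
Lemma gen_subspace U : gen U -> is_subspace U.
Proof. by move/gen_ti/(@ti_subspace _ _ _ _ _). Qed.

Lemma gen_iso U u : gen U -> u \in U -> iso u.
Proof. by case/gen_ti/(tiP _ _ _) => _ isoU _; apply: isoU. Qed.

Lemma gen_perp U u v : gen U -> u \in U -> v \in U -> g u v = 0.
Proof. by case/gen_ti/(tiP _ _ _) => _ _ gU; apply: gU. Qed.

(** Otherwise adjoining [v] to [U] would give a totally isotropic subspace with more than q^d
    vectors. *)
Lemma gen_maximal U v : gen U -> iso v -> v \in orth U -> v \in U.
Proof.
move=> genU isov /orthP vU; apply: contraT => nvU.
have ti' : ti (span_add v U).
  apply: (ti_span_add gP) => // [|u uU]; first exact: gen_ti.
  exact: (polar_refl gP (vU u uU)).
have := ti_max ti'; rewrite card_span_add ?gen_subspace // (card_gen genU).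
by rewrite -expnS leq_exp2l ?card_scalars_gt1 // ltnn.
Qed.

Lemma gen_not_perp U x : gen U -> iso x -> x \notin U -> exists2 u, u \in U & g u x != 0.
Proof.
move=> genU isox xU; apply/exists_inP; apply: contraR xU; rewrite negb_exists_in.
move/forall_inP=> h; apply: gen_maximal => //; apply/orthP=> u uU.
by apply: (polar_refl gP); apply/eqP; rewrite -[_ == 0]negbK h.
Qed.

Lemma card_gen_perp U x :
  gen U -> iso x -> x \notin U -> #|U :&: perp x| = (q ^ d.-1)%N.
Proof.
move=> genU isox xU; have [u uU ux] := gen_not_perp genU isox xU.
have := card_perpI gP (gen_subspace genU) uU ux; rewrite (card_gen genU).
rewrite -{1}(prednK d_gt0) expnS => /eqP; rewrite eqn_pmul2l ?(ltnW (card_scalars_gt1 F)) //.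
by move/eqP.
Qed.

(** [U :&: perp x] is a hyperplane of [U] orthogonal to [x], so adjoining [x] restores dimension d.
    This yields generators through given points, and later the steps of the dual polar graph. *)
Lemma gen_exchange U x :
  gen U -> iso x -> x \notin U -> gen (span_add x (U :&: perp x)).
Proof.
move=> genU isox xU.
have sI : is_subspace (U :&: perp x) by rewrite subspaceI ?(gen_subspace genU) ?(subspace_perp gP).
apply/andP; split.
  apply: (ti_span_add gP) => // [|u].
    by apply: ti_sub (gen_ti genU) sI (subsetIl _ _).
  by rewrite !inE => /andP[_ /eqP].
rewrite card_span_add ?inE ?negb_and ?xU // card_gen_perp //.
by rewrite -expnS prednK.
Qed.

Lemma gen_extend U x : gen U -> iso x ->
  exists W, [/\ gen W, x \in W & U :&: perp x \subset W].
Proof.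
move=> genU isox; have [xU|xU] := boolP (x \in U).
  by exists U; split; rewrite ?subsetIl.
exists (span_add x (U :&: perp x)); split; first exact: gen_exchange.
  by rewrite span_add_l // subspaceI ?(gen_subspace genU) ?(subspace_perp gP).
exact: span_add_r.
Qed.

Lemma gen_through x : iso x -> exists2 U, gen U & x \in U.
Proof.
by have [U genU] := gen_ex; move=> /(gen_extend genU)[W [genW xW _]]; exists W.
Qed.

(** Exchange a generator through [x] along [y]: the vector [x] survives because it lies in
    [perp y]. *)
Lemma gen_through2 x y :
  iso x -> iso y -> g x y = 0 -> exists U, [/\ gen U, x \in U & y \in U].
Proof.
move=> isox isoy gxy; have [U genU xU] := gen_through isox.
have [W [genW yW /subsetP sub]] := gen_extend genU isoy.
by exists W; split=> //; apply: sub; rewrite !inE xU gxy eqxx.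
Qed.

Lemma card_V : #|[set: V]| = (q ^ n)%N.
Proof. by rewrite cardsT card_mx mul1n. Qed.

Lemma card_orth_gen U : gen U -> (#|orth U| * q ^ d = q ^ n)%N.
Proof. by move=> genU; rewrite -(card_gen genU) -(card_orth gP (gen_ti genU)) card_V. Qed.

Lemma expq_gt0 m : (0 < q ^ m)%N.
Proof. by rewrite expn_gt0 ltnW ?card_scalars_gt1. Qed.

Lemma double_witt_leq : (2 * d <= n)%N.
Proof.
have [U genU] := gen_ex.
rewrite -(@leq_exp2l q) ?card_scalars_gt1 // -(card_orth_gen genU) mul2n -addnn expnD.
rewrite leq_mul2r -{2}(card_gen genU) subset_leq_card ?orbT //.
exact/ti_sub_orth/gen_ti.
Qed.

Lemma card_orth_genE U : gen U -> #|orth U| = (q ^ (n - d))%N.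
Proof.
move=> genU; apply/eqP; rewrite -(eqn_pmul2r (expq_gt0 d)) (card_orth_gen genU) -expnD subnK //.
by apply: leq_trans double_witt_leq; rewrite leq_pmull.
Qed.

Lemma iso_in_orth_gen U : gen U -> iso_in (orth U) = U.
Proof.
move=> genU; apply/setP=> v; rewrite [LHS]inE; apply/andP/idP=> [[vO isov]|vU].
  exact: gen_maximal.
by rewrite (subsetP (ti_sub_orth (gen_ti genU))) ?(gen_iso genU).
Qed.

(** The counting principle with T = U, where [orth U] has only the isotropic vectors of [U]. It
    applies to the whole space, the perp of a point and the common perp of two collinear points. *)
Lemma card_iso_gen W U : is_subspace W -> gen U -> orth U \subset W ->
  (q0 * #|iso_in W| + q ^ (n - d) = q0 * q ^ d + #|W|)%N.
Proof.
move=> sW genU OW; have UW := subset_trans (ti_sub_orth (gen_ti genU)) OW.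
have := card_iso_in gP sW (gen_ti genU) UW; rewrite (setIidPr OW).
by rewrite iso_in_orth_gen // card_orth_genE // (card_gen genU).
Qed.

Lemma card_iso_all : (q0 * #|iso_in [set: V]| + q ^ (n - d) = q0 * q ^ d + q ^ n)%N.
Proof.
have [U genU] := gen_ex.
by rewrite (card_iso_gen _ genU) ?subsetT ?card_V //; apply: subspaceT.
Qed.

Lemma n_gt1 : (1 < n)%N. Proof. by have := double_witt_leq; lia. Qed.

Lemma card_perpE x : iso x -> x != 0 -> #|perp x| = (q ^ n.-1)%N.
Proof.
move=> isox x0; apply/eqP; have := expq_gt0 1; rewrite expn1 => q_pos.
rewrite -(eqn_pmul2l q_pos) (card_perp gP) // card_V -expnS prednK //.
exact: ltnW n_gt1.
Qed.

Lemma card_iso_perp x : iso x -> x != 0 ->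
  (q0 * #|iso_in (perp x)| + q ^ (n - d) = q0 * q ^ d + q ^ n.-1)%N.
Proof.
move=> isox x0; have [U genU xU] := gen_through isox.
by rewrite (card_iso_gen _ genU) ?card_perpE ?orth_sub_perp // (subspace_perp gP).
Qed.

Lemma card_perp2E x y w : iso x -> x != 0 -> w \in perp x -> g w y != 0 ->
  #|perp x :&: perp y| = (q ^ n.-2)%N.
Proof.
move=> isox x0 wx wy; apply/eqP; have := expq_gt0 1; rewrite expn1 => q_pos.
rewrite -(eqn_pmul2l q_pos) -(card_perpI gP (subspace_perp gP x) wx wy) card_perpE //.
by rewrite -expnS; have := n_gt1; case: (n) => [|[]].
Qed.

(** If [perp x] were inside [perp y], some combination c x + y would be isotropic and in the
    radical, hence zero, and [y] would be a multiple of [x]. *)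
Lemma perp_not_sub x y : iso x -> iso y -> x != 0 -> g x y = 0 -> y \notin line x ->
  exists2 w, w \in perp x & g w y != 0.
Proof.
move=> isox isoy x0 gxy yx; apply/exists_inP; apply: contraR yx.
rewrite negb_exists_in => /forall_inP h.
have xy v : g v x = 0 -> g v y = 0.
  by move=> gvx; apply/eqP; rewrite -[_ == 0]negbK h // inE gvx.
have [w wx] := iso_not_radical gP isox x0.
have xw : g x w != 0 by rewrite (polar_sym gP).
(* The scalar is forced by orthogonality of c x + y to [w]. *)
apply/lineP; exists (g y w / g x w); apply/eqP; rewrite -subr_eq0 addrC -scaleNr.
set c := - _; apply/eqP; apply: (polar_nondeg gP) => [|v].
  apply: (polar_isoD gP) => //; first exact: (polar_isoZ gP).
  by rewrite (polarZ gP) gxy mulr0.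
have cw : g w (c *: x + y) = 0.
  by apply: (polar_refl gP); rewrite (polar_lin gP) /c mulNr divfK // addNr.
(* V is the sum of [perp x] and the line of [w], and c x + y is orthogonal to both. *)
have -> : v = (g v x / g w x) *: w + (v - (g v x / g w x) *: w) by rewrite addrC subrK.
have v'x : g (v - (g v x / g w x) *: w) x = 0.
  by rewrite addrC -scaleNr (polar_lin gP) mulNr divfK // addNr.
rewrite (polar_lin gP) cw mulr0 add0r; apply: (polar_r_lin0 gP) => //.
exact: xy.
Qed.

Lemma card_iso_perp2 x y : iso x -> iso y -> x != 0 -> g x y = 0 -> y \notin line x ->
  (q0 * #|iso_in (perp x :&: perp y)| + q ^ (n - d) = q0 * q ^ d + q ^ n.-2)%N.
Proof.
move=> isox isoy x0 gxy yx; have [w wx wy] := perp_not_sub isox isoy x0 gxy yx.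
have [U [genU xU yU]] := gen_through2 isox isoy gxy.
rewrite (card_iso_gen _ genU) ?(card_perp2E isox x0 wx wy) //.
  by rewrite subspaceI ?(subspace_perp gP).
by rewrite subsetI !orth_sub_perp.
Qed.

(* For a non-orthogonal pair, fibre over U :&: perp y, where U is a generator through x. *)
Lemma card_iso_perp2_hyp x y : iso x -> iso y -> x != 0 -> g x y != 0 ->
  (q0 * #|iso_in (perp x :&: perp y)| + q ^ (n - d).-1 = q0 * q ^ d.-1 + q ^ n.-2)%N.
Proof.
move=> isox isoy x0 gxy; have [U genU xU] := gen_through isox.
have [sU tU] := (gen_subspace genU, gen_ti genU).
have sT : is_subspace (U :&: perp y) by rewrite subspaceI ?(subspace_perp gP).
have tT : ti (U :&: perp y) by apply: ti_sub tU sT (subsetIl _ _).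
have yU : y \notin U by apply: contra gxy => yU; rewrite (gen_perp genU).
have gxx := polar_self gP isox.
have xperp : x \in perp x by rewrite inE gxx.
(* [U] is spanned by [x] and [U :&: perp y], so inside [perp x] orthogonality to the latter is
   orthogonality to [U]. *)
have orthT : (perp x :&: perp y) :&: orth (U :&: perp y) = orth U :&: perp y.
  apply/setP=> v; rewrite !in_setI; case vy: (v \in perp y); rewrite ?andbF ?andbT //=.
  apply/andP/idP=> [[vx /orthP vT]|vO]; last first.
    by rewrite (subsetP (orth_sub_perp _ xU)) // (subsetP (orthS _ (subsetIl _ _))).
  apply/orthP=> u uU; set c := g u y / g x y.
  have -> : u = c *: x + (- c *: x + u) by rewrite addrA -scalerDl subrr scale0r add0r.
  apply: (polar_r_lin0 gP); first by move: vx; rewrite inE => /eqP.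
  apply: vT; rewrite in_setI subspaceZD //= inE (polar_lin gP) /c mulNr divfK //.
  by rewrite addNr.
have cO : #|orth U :&: perp y| = (q ^ (n - d).-1)%N.
  have xO : x \in orth U by rewrite (subsetP (ti_sub_orth tU)).
  have := card_perpI gP (subspace_orth gP U) xO gxy; rewrite card_orth_genE //.
  have nd : (0 < n - d)%N by have := double_witt_leq; lia.
  rewrite -{1}(prednK nd) expnS => /eqP; rewrite eqn_pmul2l ?(ltnW (card_scalars_gt1 F)) //.
  by move/eqP.
have isoO : iso_in (orth U :&: perp y) = U :&: perp y.
  apply/setP=> v; rewrite -[in RHS](iso_in_orth_gen genU) !in_setI ![_ \in iso_in _]in_set.
  by rewrite in_setI andbAC.
have := card_iso_in gP _ tT _; rewrite -/iso_in => /(_ (perp x :&: perp y)).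
rewrite orthT isoO cO card_gen_perp // (card_perp2E isox x0 xperp gxy); apply.
  by rewrite subspaceI ?(subspace_perp gP).
by rewrite setSI // (subset_trans (ti_sub_orth tU)) ?orth_sub_perp.
Qed.
End Generators.

(** * Ranks from strongly regular eigenspaces *)

(** Factor E = C R through its rank r; idempotence cancels to R C = 1, and the trace of C R is that
    of R C. *)
Lemma idempotent_rank (K : fieldType) (m : nat) (E : 'M[K]_m) :
  E *m E = E -> \tr E = (\rank E)%:R.
Proof.
have := row_base_free E; have := col_base_full E; have := mulmx_base E.
move: (col_base E) (row_base E); move: (\rank E) => r C R <-.
case/row_fullP=> C' C'C /row_freeP[R' RR'].
move/(congr1 (fun X => C' *m X *m R')); rewrite -!mulmxA RR' !mulmx1 C'C.
by rewrite [C' *m _]mulmxA C'C mul1mx mxtrace_mulC => ->; rewrite mxtrace1.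
Qed.

(* B has eigenvalues kap, a and - a * eps, and the E of the proof is the projection onto
   the eigenspace of a in the orthogonal of the all-one vector. *)
Lemma rank_le_srg (K : realFieldType) (G N : nat) (M : 'M[K]_(G, N)) (B : 'M[K]_N)
    (a eps Q m kap c s : K) :
  0 < a -> 0 < eps -> 1 < Q ->
  B *m B = (a ^+ 2 * eps)%:M + (a * (1 - eps)) *: B + m *: const_mx 1 ->
  B *m const_mx 1 = kap *: (const_mx 1 : 'M_N) ->
  const_mx 1 *m B = kap *: (const_mx 1 : 'M_N) ->
  M *m B = a *: M + c *: const_mx 1 ->
  M *m const_mx 1 = s *: (const_mx 1 : 'M_(G, N)) ->
  (forall i, B i i = 1) ->
  (Q - 1) * N%:R = (Q * a - 1) * (Q * a * eps + 1) ->
  (Q - 1) * m = (a - 1) * (a * eps + 1) ->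
  (Q - 1) * kap = Q * a + Q * a ^+ 2 * eps - Q * a * eps - 1 ->
  (\rank M)%:R <=
    (Q * a * eps + 1) * (Q * a * eps - eps + Q - 1) / ((eps + 1) * (Q - 1)).
Proof.
move=> a0 e0 Q1 BB BJ JB MB MJ Bii eN em ekap.
pose J : 'M[K]_N := const_mx 1.
have JJ : J *m J = N%:R *: J.
  apply/matrixP=> i j; rewrite !mxE mulr1 (eq_bigr (fun=> 1)) => [|l _].
    by rewrite sumr_const card_ord.
  by rewrite !mxE mulr1.
have Qae : 0 < Q * a * eps by rewrite !mulr_gt0 //; lra.
have ae : 0 < a * eps by rewrite mulr_gt0.
have nz1 : Q - 1 != 0 by lra.
have nz2 : 1 + Q * a * eps != 0 by lra.
have nz3 : 1 + eps != 0 by lra.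
have nz4 : a != 0 by lra.
(* Chosen so that kap + a * eps = gam * N: then [D] kills the all-one vector. It also kills the
   eigenspace of - a * eps and acts on that of a as a * (1 + eps). *)
pose gam := (1 + a * eps) / (1 + Q * a * eps).
pose D := B + (a * eps)%:M - gam *: J.
have N_E : N%:R = (Q * a - 1) * (Q * a * eps + 1) / (Q - 1) by rewrite -eN; field.
have m_E : m = (a - 1) * (a * eps + 1) / (Q - 1) by rewrite -em; field.
have kap_E : kap = (Q * a + Q * a ^+ 2 * eps - Q * a * eps - 1) / (Q - 1).
  by rewrite -ekap; field.
have DD : D *m D = (a * (1 + eps)) *: D.
  rewrite {1 2}/D !mulmxDl !mulmxDr !mulNmx !mulmxN -!scalemxAl -!scalemxAr.
  rewrite !mul_scalar_mx !mul_mx_scalar -/J BB BJ JB JJ -!/J.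
  apply/matrixP=> i j; rewrite !mxE.
  case: (i == j); rewrite ?mulr1n ?mulr0n N_E m_E kap_E /gam; by field; rewrite ?nz1 ?nz2.
pose E := (a * (1 + eps))^-1 *: D.
have EE : E *m E = E.
  rewrite /E -scalemxAl -scalemxAr DD !scalerA; congr (_ *: _).
  by field; rewrite nz3 nz4.
have trE : \tr E = (Q * a - 1) * (1 + a * eps) * Q * eps / ((Q - 1) * (1 + eps)).
  rewrite /E mxtraceZ /D !raddfB !raddfD /= mxtraceZ mxtrace_scalar.
  have -> : \tr B = N%:R.
    by rewrite /mxtrace (eq_bigr (fun=> 1)) ?sumr_const ?card_ord.
  have -> : \tr J = N%:R.
    rewrite /mxtrace (eq_bigr (fun=> 1)) ?sumr_const ?card_ord // => i _.
    by rewrite mxE.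
  rewrite -[(a * eps) *+ N]mulr_natr N_E /gam.
  by field; rewrite nz1 nz2 nz3 nz4.
pose c' := (a * (1 + eps))^-1 * (c - gam * s).
(* The rows of M are fixed by [E] up to a multiple of the all-one vector. *)
have ME : M *m E = M + c' *: const_mx 1.
  rewrite /E -scalemxAr /D mulmxDr mulmxN mulmxDr -scalemxAr MB MJ mul_mx_scalar.
  apply/matrixP=> i j; rewrite !mxE /c'.
  by field; rewrite nz3 nz4.
have rk : (\rank M <= \rank E + 1)%N.
  have -> : M = M *m E + (- c') *: const_mx 1 by rewrite ME scaleNr addrK.
  apply: leq_trans (mxrank_add _ _) _; apply: leq_add; first exact: mxrankM_maxr.
  apply: leq_trans (mxrank_scale _ _) _.
  have -> : const_mx 1 = (const_mx 1 : 'cV_G) *m (const_mx 1 : 'rV_N) :> 'M[K]_(G, N).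
    by apply/matrixP=> i j; rewrite !mxE big_ord1 !mxE mulr1.
  exact: mulmx_max_rank.
apply: (@le_trans _ _ (\tr E + 1)).
  by rewrite (idempotent_rank EE) natr1 ler_nat -addn1.
(* The claimed bound is exactly the trace of [E] plus 1. *)
rewrite trE le_eqVlt; apply/orP; left; apply/eqP.
by field; rewrite nz1 addrC nz3.
Qed.

(** * The incidence matrix *)

Section PolarSpace.
Variables (F : finFieldType) (n : nat) (k : polar_kind).
Local Notation V := 'rV[F]_n.
Local Notation q := #|F|.
Variables (f : V -> V -> F) (Q : V -> F) (g : V -> V -> F) (iso : pred V) (q0 : nat).
Implicit Types (T U W : {set V}) (u v w x y : V).
Hypothesis gP : polar_axioms g iso q0.
Hypothesis tot_isoE : forall T, tot_iso k f Q T = tot_iso_for g iso T.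
Local Notation ti := (tot_iso_for g iso).
Local Notation perp := (perp g).
Local Notation iso_in := (iso_in iso).
Local Notation d := (witt_index k f Q).
Local Notation gen := (gen g iso d).
Hypothesis d_gt0 : (0 < d)%N.

Lemma ti_max_witt T : ti T -> (#|T| <= q ^ d)%N.
Proof.
move=> tiT; rewrite -(sdim_leP _ (ti_subspace tiT)).
by apply: leq_bigmax_cond; rewrite tot_isoE.
Qed.

Lemma is_generatorE U : is_generator k f Q U = gen U.
Proof.
rewrite /is_generator tot_isoE /gen; case: (boolP (ti U)) => //= /ti_subspace sU.
exact: sdim_eqP.
Qed.

Lemma gen_ex_witt : exists U, gen U.
Proof.
have ti0 : (0 < #|[pred T | tot_iso k f Q T]|)%N.
  apply/card_gt0P; exists (line 0); rewrite inE tot_isoE.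
  by apply: (ti_line gP); apply: (polar_iso0 gP).
have [U tiU maxU] := eq_bigmax_cond (@sdim F n) ti0.
exists U; rewrite -is_generatorE; apply/andP; split; first exact: tiU.
by rewrite /witt_index -maxU.
Qed.

Lemma is_pointE U : is_point k f Q U = ti U && (#|U| == q).
Proof.
rewrite /is_point tot_isoE; case: (boolP (ti U)) => //= /ti_subspace sU.
by rewrite sdim_eqP // expn1.
Qed.

Lemma point_rep (p : point k f Q) :
  exists x, [&& x != 0, iso x & val p == line x].
Proof.
case: p => U /=; rewrite is_pointE => /andP[tiU /eqP cU].
have [sU isoU _] := tiP _ _ _ tiU.
have : (1 < #|U|)%N by rewrite cU card_scalars_gt1.
rewrite (cardD1 0) subspace0 //= add1n ltnS => /card_gt0P[x].
rewrite !inE => /andP[x0 xU]; exists x; rewrite x0 isoU //=.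
by rewrite eq_sym eqEcard line_sub // xU card_line // cU leqnn.
Qed.

(** One vector per point turns incidence into membership and collinearity into vanishing of [g]. *)
Definition rep (p : point k f Q) : V := xchoose (point_rep p).

Lemma rep_neq0 p : rep p != 0.
Proof. by case/and3P: (xchooseP (point_rep p)). Qed.

Lemma rep_iso p : iso (rep p).
Proof. by case/and3P: (xchooseP (point_rep p)). Qed.

Lemma point_line p : val p = line (rep p).
Proof. by case/and3P: (xchooseP (point_rep p)) => _ _ /eqP. Qed.

Lemma line_scale a x : a != 0 -> line (a *: x) = line x.
Proof.
move=> a0; apply/setP=> v; apply/lineP/lineP=> -[b ->].
  by exists (b * a); rewrite scalerA.
by exists (b / a); rewrite scalerA divfK.
Qed.

Lemma line_is_point x : iso x -> x != 0 -> is_point k f Q (line x).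
Proof. by move=> isox x0; rewrite is_pointE (ti_line gP) //= card_line. Qed.

Local Notation NP := #|{: point k f Q}|.
Local Notation NG := #|{: generator k f Q}|.
Definition pnt (j : 'I_NP) : V := rep (enum_val j).
Definition gnr (i : 'I_NG) : {set V} := val (enum_val i).

Lemma pnt_neq0 j : pnt j != 0. Proof. exact: rep_neq0. Qed.
Lemma pnt_iso j : iso (pnt j). Proof. exact: rep_iso. Qed.

Lemma gnr_gen i : gen (gnr i).
Proof. by rewrite -is_generatorE; apply: valP. Qed.

Lemma pnt_line_inj i j : pnt i \in line (pnt j) -> i = j.
Proof.
case/lineP=> a e; apply/enum_val_inj/val_inj; rewrite !point_line -!/(pnt _) e line_scale //.
by apply: contra (pnt_neq0 i); rewrite e => /eqP ->; rewrite scale0r.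
Qed.

(* Each point carries q - 1 nonzero vectors. *)
Lemma card_points W : is_subspace W ->
  (q.-1 * #|[set j | pnt j \in W]|).+1 = #|iso_in W|.
Proof.
move=> sW; rewrite [RHS](cardD1 0) !inE subspace0 // (polar_iso0 gP) add1n; congr _.+1.
rewrite -(cardsC1 (0 : F)) -cardsX -(card_in_imset (f := fun p => p.1 *: pnt p.2)).
  apply: eq_card => v; rewrite !inE; apply/imsetP/and3P=> [[[a j]]|[v0 vW isov]].
    rewrite !inE => /andP[/= a0 jW] ->.
    by rewrite scaler_eq0 negb_or a0 pnt_neq0 subspaceZ // (polar_isoZ gP) ?pnt_iso.
  pose p : point k f Q := Sub (line v) (line_is_point isov v0).
  have : v \in line (pnt (enum_rank p)).
    by rewrite /pnt enum_rankK -point_line mem_line.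
  case/lineP=> a va; exists (a, enum_rank p) => //.
  have a0 : a != 0 by apply: contra (v0); rewrite va => /eqP ->; rewrite scale0r.
  by rewrite !inE a0 /= -(subspace_scale _ sW a0) -va.
move=> [a i] [b j]; rewrite !inE /= => /andP[a0 _] /andP[b0 _] e.
have ij : i = j.
  apply: pnt_line_inj; apply/lineP; exists (a^-1 * b).
  by rewrite -scalerA -e scalerA mulVf // scale1r.
by move: e; rewrite ij => /(scaler_inj (pnt_neq0 j)) ->.
Qed.

Lemma iso_in_ti U : ti U -> iso_in U = U.
Proof.
case/tiP=> _ isoU _; apply/setP=> v; rewrite inE.
by case: (boolP (v \in U)) => //= /isoU.
Qed.

Lemma incidenceE i j : incidence_matrix k f Q i j = (pnt j \in gnr i)%:R :> R.
Proof.
rewrite mxE point_line line_sub ?(gen_subspace (gnr_gen i)) //.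
by rewrite -/(pnt j) -/(gnr i); case: ifP.
Qed.

(** * Real-valued point counts and the rank of the incidence matrix *)

Hypothesis q0_gt0 : (0 < q0)%N.
Local Notation M := (incidence_matrix k f Q).
Definition qR := q%:R : R.
(** The size of a hyperplane of a generator; also the eigenvalue [a] to which [rank_le_srg] is
    applied. *)
Definition hyp_card := qR ^+ d.-1.
(* This is q^(e-1). *)
Definition polar_eps := qR ^+ (n - 2 * d) / q0%:R.


Lemma qR_gt1 : 1 < qR. Proof. by rewrite /qR ltr1n card_scalars_gt1. Qed.

Lemma q0_neq0 : q0%:R != 0 :> R. Proof. by rewrite pnatr_eq0 -lt0n. Qed.

Lemma polar_eps_gt0 : 0 < polar_eps.
Proof.
by rewrite divr_gt0 ?ltr0n // exprn_gt0 // (lt_trans ltr01 qR_gt1).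
Qed.

Lemma hyp_card_gt0 : 0 < hyp_card.
Proof. by rewrite /hyp_card exprn_gt0 // (lt_trans ltr01 qR_gt1). Qed.

(** Eliminates n: powers of q become monomials in [qR], [hyp_card] and [polar_eps], with a factor q0
    that cancels in the counts. *)
Lemma exp_split s m : (m = n - 2 * d + s)%N -> (q ^ m)%:R = q0%:R * polar_eps * qR ^+ s.
Proof.
by move=> ->; rewrite natrX -/qR exprD /polar_eps [q0%:R * _]mulrC divfK // q0_neq0.
Qed.

(** Turns a count of isotropic vectors into a count of points: divide by q0 and remove the zero
    vector. *)
Lemma card_points_real W (A C D : nat) (x y z : R) :
  is_subspace W -> (q0 * #|iso_in W| + A = q0 * C + D)%N ->
  C%:R = x -> D%:R = q0%:R * polar_eps * y -> A%:R = q0%:R * polar_eps * z ->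
  (qR - 1) * #|[set j | pnt j \in W]|%:R = x + polar_eps * y - polar_eps * z - 1.
Proof.
move=> sW e eC eD eA; move: (card_points sW); set N := #|[set j | _]| => eN.
move/(congr1 (fun m => m%:R : R)): e; rewrite !natrD !natrM eC eD eA -eN.
have -> : (q.-1 * N).+1%:R = (qR - 1) * N%:R + 1 :> R.
  by rewrite -natr1 natrM -subn1 natrB ?(ltnW (card_scalars_gt1 F)).
move=> e; apply: (mulfI q0_neq0); move: e; clear; set X := _ * N%:R.
by move: X => X e; lra.
Qed.

Let dn := double_witt_leq gP gen_ex_witt.

Lemma hyp_card_exp : qR ^+ d = qR * hyp_card. Proof. by rewrite /hyp_card -exprS prednK. Qed.

Lemma hyp_card_exp2 s : (s + 2 = 2 * d)%N -> qR ^+ s = hyp_card ^+ 2.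
Proof. by move=> e; rewrite /hyp_card -exprM; congr (_ ^+ _); lia. Qed.

Lemma exp_nE : (q ^ n)%:R = q0%:R * polar_eps * (qR ^+ 2 * hyp_card ^+ 2).
Proof.
by rewrite (@exp_split (2 + (2 * d - 2))) ?exprD ?(@hyp_card_exp2 (2 * d - 2)) //; lia.
Qed.

Lemma exp_n1E : (q ^ n.-1)%:R = q0%:R * polar_eps * (qR * hyp_card ^+ 2).
Proof.
by rewrite (@exp_split (1 + (2 * d - 2))) ?exprD ?(@hyp_card_exp2 (2 * d - 2)) //; lia.
Qed.

Lemma exp_n2E : (q ^ n.-2)%:R = q0%:R * polar_eps * hyp_card ^+ 2.
Proof. by rewrite (@exp_split (2 * d - 2)) ?(@hyp_card_exp2 (2 * d - 2)) //; lia. Qed.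

Lemma exp_ndE : (q ^ (n - d))%:R = q0%:R * polar_eps * (qR * hyp_card).
Proof. by rewrite (@exp_split d) ?hyp_card_exp //; lia. Qed.

Lemma exp_nd1E : (q ^ (n - d).-1)%:R = q0%:R * polar_eps * hyp_card.
Proof. by rewrite (@exp_split d.-1) //; lia. Qed.

Lemma exp_dE : (q ^ d)%:R = qR * hyp_card.
Proof. by rewrite natrX hyp_card_exp. Qed.

Lemma exp_d1E : (q ^ d.-1)%:R = hyp_card :> R.
Proof. by rewrite natrX. Qed.

Lemma NP_E : (qR - 1) * NP%:R = (qR * hyp_card - 1) * (qR * hyp_card * polar_eps + 1).
Proof.
have e := card_iso_all gP ti_max_witt gen_ex_witt.
have := card_points_real (subspaceT F n) e exp_dE exp_nE exp_ndE.
have -> : #|[set j | pnt j \in [set: V]]| = NP.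
  by rewrite -[RHS]card_ord; apply: eq_card => j; rewrite !inE.
by move=> ->; move: hyp_card polar_eps qR => b c r; ring.
Qed.

Definition collinear_deg :=
  (qR * hyp_card + qR * hyp_card ^+ 2 * polar_eps - qR * hyp_card * polar_eps - 1) / (qR - 1).
(** The number of points collinear with both of two non-collinear points. *)
Definition collinear_mu := (hyp_card - 1) * (hyp_card * polar_eps + 1) / (qR - 1).

Lemma Q1_neq0 : qR - 1 != 0. Proof. by rewrite subr_eq0 gt_eqF ?qR_gt1. Qed.

Lemma card_collinear i : #|[set l | pnt l \in perp (pnt i)]|%:R = collinear_deg.
Proof.
have e := card_iso_perp gP d_gt0 ti_max_witt gen_ex_witt (pnt_iso i) (pnt_neq0 i).
have := card_points_real (subspace_perp gP _) e exp_dE exp_n1E exp_ndE.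
move=> h; apply: (mulfI Q1_neq0); rewrite h /collinear_deg [RHS]mulrC divfK ?Q1_neq0 //.
by move: hyp_card polar_eps qR => b c r; ring.
Qed.

(** The (i, j) entry of B^2. Equal, collinear and non-collinear pairs are merged into one formula,
    which is the quadratic equation for B. *)
Lemma card_collinear2 i j :
  #|[set l | pnt l \in perp (pnt i) :&: perp (pnt j)]|%:R =
    hyp_card ^+ 2 * polar_eps *+ (i == j)
    + hyp_card * (1 - polar_eps) * (g (pnt i) (pnt j) == 0)%:R + collinear_mu.
Proof.
have [isoi isoj] := (pnt_iso i, pnt_iso j).
have i0 := pnt_neq0 i.
have Q1 := Q1_neq0.
have [ij|ij] := eqVneq i j.
  rewrite -ij setIid card_collinear (polar_self gP) // eqxx /collinear_deg /collinear_mu /= ?mulr1n.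
  by move: hyp_card polar_eps qR Q1 => b c r nz; field.
have sI : is_subspace (perp (pnt i) :&: perp (pnt j)) by rewrite subspaceI ?(subspace_perp gP).
have [gij|gij] := eqVneq (g (pnt i) (pnt j)) 0.
  have jl : pnt j \notin line (pnt i).
    by apply: contra ij => /pnt_line_inj ->.
  have e := card_iso_perp2 gP d_gt0 ti_max_witt gen_ex_witt isoi isoj i0 gij jl.
  have h := card_points_real sI e exp_dE exp_n2E exp_ndE.
  apply: (mulfI Q1); rewrite h /collinear_mu /= ?mulr0n ?mulr1n.
  by move: hyp_card polar_eps qR Q1 => b c r nz; field.
have e := card_iso_perp2_hyp gP d_gt0 ti_max_witt gen_ex_witt isoi isoj i0 gij.
have h := card_points_real sI e exp_d1E exp_n2E exp_nd1E.
apply: (mulfI Q1); rewrite h /collinear_mu /= ?mulr0n ?mulr1n.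
by move: hyp_card polar_eps qR Q1 => b c r nz; field.
Qed.

(** The (i, j) entry of M B: the perp of a point contains a generator through that point and cuts
    any other generator in a hyperplane. *)
Lemma card_gnr_perp i j :
  #|[set l | pnt l \in gnr i :&: perp (pnt j)]|%:R =
    hyp_card * (pnt j \in gnr i)%:R + (hyp_card - 1) / (qR - 1).
Proof.
have Q1 := Q1_neq0.
have [sU tU] := (gen_subspace (gnr_gen i), gen_ti (gnr_gen i)).
have sI : is_subspace (gnr i :&: perp (pnt j)) by rewrite subspaceI ?(subspace_perp gP).
have tI : ti (gnr i :&: perp (pnt j)) by apply: ti_sub tU sI (subsetIl _ _).
have := card_points sI; rewrite (iso_in_ti tI); set N := #|[set l | _]|.
move/(congr1 (fun m => m%:R : R)); rewrite -natr1 natrM -subn1 natrB; last first.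
  by rewrite ltnW ?card_scalars_gt1.
have -> : #|gnr i :&: perp (pnt j)|%:R = if pnt j \in gnr i then qR * hyp_card else hyp_card :> R.
  case: ifP => jU; last first.
    by rewrite (card_gen_perp gP d_gt0 ti_max_witt (gnr_gen i)) ?pnt_iso ?jU // exp_d1E.
  rewrite (setIidPl _) ?(card_gen (gnr_gen i)) ?exp_dE //.
  by apply: subset_trans (ti_sub_orth tU) (orth_sub_perp _ jU).
move=> e; apply: (mulfI Q1); move/eqP: e; rewrite eq_sym -subr_eq => /eqP <-.
by case: ifP => _; rewrite /= ?mulr1n ?mulr0n; move: hyp_card qR Q1 => b r nz; field.
Qed.

Lemma card_gnr_pnt i :
  #|[set l | pnt l \in gnr i]|%:R = (qR * hyp_card - 1) / (qR - 1).
Proof.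
have Q1 := Q1_neq0.
have := card_points (gen_subspace (gnr_gen i)).
rewrite (iso_in_ti (gen_ti (gnr_gen i))) (card_gen (gnr_gen i)); set N := #|_|.
move/(congr1 (fun m => m%:R : R)); rewrite -natr1 natrM -subn1 natrB; last first.
  by rewrite ltnW ?card_scalars_gt1.
rewrite exp_dE => e; apply: (mulfI Q1); move/eqP: e; rewrite eq_sym -subr_eq => /eqP <-.
by move: hyp_card qR Q1 => b r nz; field.
Qed.

Lemma sum_bool (I : finType) (P : pred I) : \sum_l (P l)%:R = #|[set l | P l]|%:R :> R.
Proof.
rewrite -sum1_card natr_sum [RHS]big_mkcond; apply: eq_bigr => l _.
by rewrite inE; case: (P l).
Qed.

Lemma sum_bool2 (I : finType) (P P' : pred I) :
  \sum_l (P l)%:R * (P' l)%:R = #|[set l | P l && P' l]|%:R :> R.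
Proof. by rewrite -sum_bool; apply: eq_bigr => l _; rewrite -natrM mulnb. Qed.

Definition collinear_mx : 'M[R]_NP := \matrix_(i, j) (g (pnt i) (pnt j) == 0)%:R.

Lemma rank_incidence_le :
  (\rank M)%:R <=
    (qR * hyp_card * polar_eps + 1) * (qR * hyp_card * polar_eps - polar_eps + qR - 1)
    / ((polar_eps + 1) * (qR - 1)).
Proof.
have Q1 := Q1_neq0.
apply: (rank_le_srg (B := collinear_mx) (m := collinear_mu) (kap := collinear_deg)
                    (c := (hyp_card - 1) / (qR - 1))
                    (s := (qR * hyp_card - 1) / (qR - 1)) hyp_card_gt0 polar_eps_gt0 qR_gt1).
- apply/matrixP=> i j; rewrite !mxE mulr1 -card_collinear2.
  under eq_bigr do rewrite !mxE.
  rewrite sum_bool2; congr _%:R; apply: eq_card => l; rewrite !inE.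
  by rewrite (polar_sym gP).
- apply/matrixP=> i j; rewrite !mxE mulr1 -(card_collinear i).
  under eq_bigr do rewrite !mxE mulr1.
  by rewrite sum_bool; congr _%:R; apply: eq_card => l; rewrite !inE (polar_sym gP).
- apply/matrixP=> i j; rewrite !mxE mulr1 -(card_collinear j).
  under eq_bigr do rewrite !mxE mul1r.
  by rewrite sum_bool; congr _%:R; apply: eq_card => l; rewrite !inE.
- apply/matrixP=> i j; rewrite [LHS]mxE [RHS]mxE [X in _ = X + _]mxE [X in _ = _ + X]mxE.
  rewrite [const_mx _ _ _]mxE mulr1 incidenceE -card_gnr_perp.
  under eq_bigr do rewrite incidenceE mxE.
  by rewrite sum_bool2; congr _%:R; apply: eq_card => l; rewrite !inE.
- apply/matrixP=> i j; rewrite [LHS]mxE [RHS]mxE [const_mx _ _ _]mxE mulr1 -(card_gnr_pnt i).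
  under eq_bigr do rewrite incidenceE mxE mulr1.
  by rewrite sum_bool.
- by move=> i; rewrite mxE (polar_self gP) ?eqxx // pnt_iso.
- exact: NP_E.
- by rewrite /collinear_mu mulrC divfK.
- by rewrite /collinear_deg mulrC divfK.
Qed.
End PolarSpace.

(** * Distances in the dual polar graph *)

(** Take rows forming a basis of the row space: every row is a combination of them, so columns that
    agree on these rows agree everywhere. *)
Lemma rank_many_rows (K : fieldType) (m p : nat) (A : 'M[K]_(m, p)) :
  exists2 S : {set 'I_m}, (#|S| <= \rank A)%N &
    forall u w, {in S, forall x, A x u = A x w} -> forall y, A y u = A y w.
Proof.
exists [set maxrankfun A i | i in 'I_(\rank A)] => [|u w eqA y].
  by rewrite (leq_trans (leq_imset_card _ _)) // cardT size_enum_ord.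
have : (row y A <= rowsub (maxrankfun A) A)%MS by rewrite eq_maxrowsub row_sub.
case/submxP=> D eD.
have Ay t : A y t = \sum_i D 0 i * A (maxrankfun A i) t.
  move/rowP/(_ t): eD; rewrite !mxE => ->.
  by apply: eq_bigr => i _; rewrite mxE.
by rewrite !Ay; apply: eq_bigr => i _; rewrite eqA ?imset_f.
Qed.

Lemma bigmin_leq (I : eqType) (r : seq I) (P : pred I) (G : I -> nat) (N : nat) i :
  i \in r -> P i -> (\big[minn/N]_(j <- r | P j) G j <= G i)%N.
Proof.
elim: r => // j r IHr; rewrite inE big_cons => /predU1P[<- ->|ir Pi].
  exact: geq_minl.
case: ifP => _; last exact: IHr.
exact: leq_trans (geq_minr _ _) (IHr ir Pi).
Qed.

Lemma metric_dim_leq (T : finType) (e : rel T) (S : {set T}) :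
  resolving e S -> (metric_dim e <= #|S|)%N.
Proof. by move=> resS; apply: bigmin_leq; rewrite ?mem_index_enum. Qed.

(** Balls turn out to be given by a threshold on the radius; this evaluates the search in [gdist],
    capped by the length of the list. *)
Lemma find_geq_iota (c N s : nat) :
  find (fun m => c <= s + m)%N (iota 0 N) = minn (c - s) N.
Proof.
suff gen t : find (fun m => c <= s + m)%N (iota t N) = minn (c - (s + t)) N.
  by rewrite gen addn0.
elim: N t => [|N IHN] t /=; first by rewrite minn0.
by case: leqP => ct; rewrite ?IHN; lia.
Qed.

Lemma pred_mul_inj (r x y : nat) :
  (1 < r)%N -> (r.-1 * x).+1 = (r.-1 * y).+1 -> x = y.
Proof. by case: r => [|[|r]] // _ [] /eqP; rewrite eqn_pmul2l // => /eqP. Qed.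

Section DualPolarGraph.
Variables (F : finFieldType) (n : nat) (k : polar_kind).
Local Notation V := 'rV[F]_n.
Local Notation q := #|F|.
Variables (f : V -> V -> F) (Q : V -> F) (g : V -> V -> F) (iso : pred V) (q0 : nat).
Hypothesis gP : polar_axioms g iso q0.
Hypothesis tot_isoE : forall T, tot_iso k f Q T = tot_iso_for g iso T.
Local Notation d := (witt_index k f Q).
Local Notation gen := (gen g iso d).
Local Notation GT := (generator k f Q).
Local Notation adj := (dual_polar_adj k f Q).
Local Notation M := (incidence_matrix k f Q).
Hypothesis d_gt0 : (0 < d)%N.

Implicit Types U W Y : GT.

Lemma val_gen U : gen (val U).
Proof. by rewrite -(is_generatorE tot_isoE); apply: valP. Qed.

Lemma val_subspace U : is_subspace (val U).
Proof. exact: gen_subspace (val_gen U). Qed.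

Definition dimI U W := sdim (val U :&: val W).

Lemma card_capE U W : #|val U :&: val W| = (q ^ dimI U W)%N.
Proof. by rewrite card_subspace // subspaceI ?val_subspace. Qed.

Lemma dimI_leq U W : (dimI U W <= d)%N.
Proof.
rewrite -(@leq_exp2l q) ?card_scalars_gt1 // -card_capE -(card_gen (val_gen U)).
by rewrite subset_leq_card ?subsetIl.
Qed.

Lemma dimIxx U : dimI U U = d.
Proof.
apply/eqP; rewrite -(@eqn_exp2l q) ?card_scalars_gt1 // -card_capE setIid.
by rewrite (card_gen (val_gen U)).
Qed.

Lemma dimI_max U W : (d <= dimI U W)%N = (U == W).
Proof.
apply/idP/eqP=> [|<-]; last by rewrite dimIxx.
rewrite -(@leq_exp2l q) ?card_scalars_gt1 // -card_capE => le.
have capE Y : #|val Y| = (q ^ d)%N by apply: (card_gen (val_gen Y)).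
have eU : val U :&: val W = val U by apply/eqP; rewrite eqEcard subsetIl capE.
have eW : val U :&: val W = val W by apply/eqP; rewrite eqEcard subsetIr capE.
exact: val_inj (etrans (esym eU) eW).
Qed.

Lemma adjE U W : adj U W = (U != W) && (dimI U W == d.-1).
Proof. by []. Qed.

Lemma dimIC U W : dimI U W = dimI W U.
Proof. by rewrite /dimI setIC. Qed.

(** W and Y share a hyperplane of Y, which cuts the intersection of U and Y in codimension at most
    1, inside W. *)
Lemma adj_dimI U W Y : adj W Y -> (dimI U Y <= (dimI U W).+1)%N.
Proof.
case/andP=> _ /eqP WY.
have sI (X Z : GT) : is_subspace (val X :&: val Z) by rewrite subspaceI ?val_subspace.
have := leq_card_subspaceI (sI U Y) (sI W Y) (val_subspace Y) (subsetIr _ _) (subsetIr _ _).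
rewrite !card_capE (card_gen (val_gen Y)) [dimI W Y]WY.
have le : (#|(val U :&: val Y) :&: (val W :&: val Y)| <= q ^ dimI U W)%N.
  rewrite -card_capE subset_leq_card //; apply/subsetP=> v; rewrite !inE.
  by case/and3P=> /andP[-> _] ->.
move=> h; have := leq_trans h (leq_mul (leqnn _) le).
rewrite -!expnD leq_exp2l ?card_scalars_gt1 //; lia.
Qed.

(** Exchange W along some x of U outside W. The intersection of U and W is orthogonal to x because U
    is totally isotropic, so it survives and x is gained. *)
Lemma adj_closer U W : U != W -> exists2 Y, adj Y W & (dimI U W < dimI U Y)%N.
Proof.
move=> UW; have : ~~ (val U \subset val W).
  apply: contra UW => sub; rewrite -dimI_max -(@leq_exp2l q) ?card_scalars_gt1 //.
  by rewrite -card_capE (setIidPl sub) (card_gen (val_gen U)).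
case/subsetPn=> x xU xW; have isox := gen_iso (val_gen U) xU.
have genY := gen_exchange gP d_gt0 (ti_max_witt tot_isoE) (val_gen W) isox xW.
set Y0 := span_add _ _ in genY.
have pY : is_generator k f Q Y0 by rewrite (is_generatorE tot_isoE).
have [Y valY] : exists Y : GT, val Y = Y0 by exists (Sub Y0 pY).
have YW : val Y :&: val W = val W :&: perp g x.
  by rewrite valY span_addI ?val_subspace ?subsetIl.
exists Y.
  have dimYW : dimI Y W = d.-1.
    apply/eqP; rewrite -(@eqn_exp2l q) ?card_scalars_gt1 // -card_capE YW.
    by rewrite (card_gen_perp gP d_gt0 (ti_max_witt tot_isoE) (val_gen W)).
  by rewrite adjE dimYW eqxx andbT -dimI_max dimYW; lia.
have sUW : is_subspace (val U :&: val W) by rewrite subspaceI ?val_subspace.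
have sub : span_add x (val U :&: val W) \subset val U :&: val Y.
  apply: span_add_sub; first by rewrite subspaceI ?val_subspace.
    by rewrite inE xU valY span_add_l // subspaceI ?val_subspace ?(subspace_perp gP).
  apply/subsetP=> v; rewrite inE => /andP[vU vW]; rewrite inE vU /=.
  rewrite valY (subsetP (span_add_r _ _)) // inE vW inE.
  by rewrite (gen_perp (val_gen U)) ?eqxx.
rewrite -(@leq_exp2l q (dimI U W).+1) ?card_scalars_gt1 // expnS -!card_capE.
have xUW : x \notin val U :&: val W by rewrite inE (negPf xW) andbF.
by rewrite -(card_span_add sUW xUW) subset_leq_card.
Qed.

Lemma adjC U W : adj U W = adj W U.
Proof. by rewrite !adjE eq_sym dimIC. Qed.

(** A step changes the intersection with U by at most one dimension, and some step always gains one.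
    In particular the graph is connected. *)
Lemma mem_gball U W m : (W \in gball adj U m) = (d <= dimI U W + m)%N.
Proof.
elim: m W => [|m IHm] W; first by rewrite inE addn0 dimI_max eq_sym.
rewrite !inE IHm; apply/orP/idP=> [[|/existsP[Y /andP[]]]|le]; first by lia.
  by rewrite IHm adjC => YU /(adj_dimI U); lia.
have [->|UW] := eqVneq U W; first by left; rewrite dimIxx leq_addr.
have [Y YW lt] := adj_closer UW; right; apply/existsP; exists Y.
by rewrite IHm YW andbT; lia.
Qed.

(** Along steps from W towards U the dimension grows by exactly one, so no value is skipped. *)
Lemma dimI_intermediate U W t :
  (dimI U W <= t)%N -> (t <= d)%N -> exists Y, dimI U Y = t.
Proof.
have [j] := ubnP (t - dimI U W); elim: j W => // j IHj W lej let_ led.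
have [eqt|net] := eqVneq (dimI U W) t; first by exists W.
have UW : U != W by rewrite -dimI_max; lia.
have [Y YW lt] := adj_closer UW.
rewrite adjC in YW; have := adj_dimI U YW => le_Y.
by apply: (IHj Y); lia.
Qed.

(* A ball of radius m around U grows at every step until it reaches W. *)
Lemma codim_leq_card U W m : (m <= d - dimI U W)%N -> (m < #|gball adj U m|)%N.
Proof.
elim: m => [|m IHm] le; first by apply/card_gt0P; exists U; rewrite inE.
apply: leq_ltn_trans (IHm (ltnW le)) _; apply: proper_card; apply/properP; split.
  exact: subsetUl.
have [||Y eY] := @dimI_intermediate U W (d - m.+1); [lia|lia|].
by exists Y; rewrite !mem_gball eY; have := dimI_leq U W; lia.
Qed.

(** The search in [gdist] stops at the number of vertices; growth of the balls shows that this cap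
    is never reached too early. *)
Lemma gdistE U W : gdist adj U W = (d - dimI U W)%N.
Proof.
rewrite /gdist (eq_find (a2 := fun m => d <= dimI U W + m)%N); last exact: mem_gball.
rewrite find_geq_iota; apply/minn_idPl.
exact: leq_trans (ltnW (codim_leq_card (leqnn (d - dimI U W)))) (max_card _).
Qed.

Lemma gramE s t :
  (M *m M^T) s t = #|[set l | pnt tot_isoE l \in gnr s :&: gnr t]|%:R.
Proof.
rewrite mxE (eq_bigr (fun l => (pnt tot_isoE l \in gnr s)%:R * (pnt tot_isoE l \in gnr t)%:R)).
  by rewrite sum_bool2; congr _%:R; apply: eq_card => l; rewrite !inE.
by move=> l _; rewrite [M^T l t]mxE !(incidenceE tot_isoE).
Qed.

Lemma gram_card s t :
  (q.-1 * #|[set l | pnt tot_isoE l \in gnr s :&: gnr t]|).+1 =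
  (q ^ dimI (enum_val s) (enum_val t))%N.
Proof.
have sI : is_subspace (gnr s :&: gnr t) by rewrite subspaceI ?val_subspace.
have tI : tot_iso_for g iso (gnr s :&: gnr t).
  exact: ti_sub (gen_ti (val_gen (enum_val s))) sI (subsetIl _ _).
by rewrite (card_points gP) // (iso_in_ti tI) -card_capE.
Qed.

Lemma gram_dimI i j i' j' :
  dimI (enum_val i) (enum_val j) = dimI (enum_val i') (enum_val j') ->
  (M *m M^T) i j = (M *m M^T) i' j'.
Proof.
move=> e; rewrite !gramE; congr _%:R.
by apply: (pred_mul_inj (card_scalars_gt1 F)); rewrite !gram_card e.
Qed.

(** Sharing as many points as one generator has forces the two generators to coincide. *)
Lemma gram_eq_diag i j : (M *m M^T) i j = (M *m M^T) i i -> i = j.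
Proof.
rewrite !gramE => /eqP; rewrite eqr_nat => /eqP e; apply/enum_val_inj/eqP.
rewrite -dimI_max -(@leq_exp2l q) ?card_scalars_gt1 // -gram_card e gram_card.
by rewrite dimIxx.
Qed.

Lemma metric_dim_leq_rank : (metric_dim adj <= \rank M)%N.
Proof.
have [S leS resS] := rank_many_rows (M *m M^T).
have leM : (#|[set enum_val i | i in S]| <= \rank M)%N.
  by rewrite (leq_trans (leq_imset_card _ _)) // (leq_trans leS) ?mxrankM_maxl.
apply: leq_trans leM; apply: metric_dim_leq.
apply/forallP=> U; apply/forallP=> W; apply/implyP; apply: contraR.
rewrite negb_exists_in => /forall_inP same.
rewrite -(enum_rankK U) -(enum_rankK W); apply/eqP; congr enum_val.
(* The columns of U and W agree on the rows in S, hence also on the row of U, where one entry is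
   diagonal. *)
apply/gram_eq_diag; symmetry; apply: resS => x xS; apply: gram_dimI.
rewrite !enum_rankK ![dimI (enum_val x) _]dimIC.
have /negPn/eqP := same _ (imset_f enum_val xS); rewrite !gdistE.
(* Both dimensions are at most d, so truncated subtraction from d can be cancelled. *)
have := dimI_leq U (enum_val x); have := dimI_leq W (enum_val x); lia.
Qed.
End DualPolarGraph.

(** * The three families of forms *)

Section Instances.
Variables (F : finFieldType) (n : nat).
Local Notation V := 'rV[F]_n.
Local Notation q := #|F|.

Section Symplectic.
Variables (f : V -> V -> F) (Q : V -> F).
Hypothesis fP : symplectic_form f.

Lemma symplectic_axioms : polar_axioms f predT 1.
Proof.
have [[linl linr] alt nondeg] := fP.
have fD u v w : f (u + v) w = f u w + f v w by rewrite -{1}[u]scale1r linl mul1r.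
have fDr u v w : f w (u + v) = f w u + f w v by rewrite -{1}[u]scale1r linr mul1r.
have refl u v : f u v = 0 -> f v u = 0.
  by move=> uv; move: (alt (u + v)); rewrite fD !fDr !alt uv !add0r addr0.
split=> // [v _ h|T v u _ _ _]; first by apply: nondeg => w; apply: refl.
by rewrite mul1n; apply: eq_card => t; rewrite inE andbT.
Qed.

Lemma symplectic_tot_iso T : tot_iso Symplectic f Q T = tot_iso_for f predT T.
Proof.
rewrite /tot_iso /tot_iso_for; congr (_ && _); rewrite [X in X && _](_ : _ = true) //.
exact/forall_inP.
Qed.
End Symplectic.

Section Quadratic.
Variables (f : V -> V -> F) (Q : V -> F).
Hypothesis QP : nondegenerate_quadratic_form Q.

Lemma quadratic_axioms : polar_axioms (polar_form Q) [pred v | Q v == 0] q.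
Proof.
have [[QZ [linl _]] nondeg] := QP.
have sym u v : polar_form Q u v = polar_form Q v u.
  by rewrite /polar_form [u + v]addrC addrAC.
have QD u v : Q (u + v) = polar_form Q u v + Q u + Q v.
  by rewrite /polar_form addrAC subrK subrK.
split=> //=.
- by move=> u v; rewrite sym.
- by rewrite -(scale0r 0) QZ expr0n mul0r.
- by move=> a v /eqP Qv; rewrite QZ Qv mulr0.
- by move=> u v /eqP Qu /eqP Qv uv; rewrite QD Qu Qv uv !addr0.
- move=> u /eqP Qu; rewrite /polar_form -{1 2}[u]scale1r -scalerDl QZ Qu mulr0.
  by rewrite !subr0.
- by move=> v /eqP Qv h; apply: nondeg => // w; rewrite sym.
move=> T v u tiT uT uv; have [sT isoT _] := tiP _ _ _ tiT.
(* Q vanishes on T, so v + t is singular exactly when the linear functional t -> polar_form Q t v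
   equals - Q v. *)
rewrite -(card_level (phi := (polar_form Q)^~ v) (- Q v) sT _ uT uv) => [|a x y]; last exact: linl.
congr (_ * _)%N; apply: eq_card => t; rewrite !inE; case tT: (t \in T) => //=.
have /eqP Qt := isoT t tT.
by rewrite QD Qt addr0 sym addr_eq0.
Qed.

Lemma quadratic_tot_iso T :
  tot_iso Quadratic f Q T = tot_iso_for (polar_form Q) [pred v | Q v == 0] T.
Proof.
rewrite /tot_iso /tot_iso_for /=; case: (boolP (is_subspace T)) => //= sT.
apply/idP/andP=> [/forall_inP QT|[] //]; split; first exact/forall_inP.
apply/forall_inP=> u uT; apply/forall_inP=> v vT; rewrite /polar_form.
have /eqP -> := QT u uT; have /eqP -> := QT v vT; have /eqP -> := QT _ (subspaceD sT uT vT).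
by rewrite !subr0.
Qed.
End Quadratic.

Section Hermitian.
Variables (sigma : {rmorphism F -> F}) (f : V -> V -> F) (Q : V -> F).

Definition fixed_field : {set F} := [set x | sigma x == x].

Hypothesis fP : hermitian_form sigma f.

Lemma fixedP x : reflect (sigma x = x) (x \in fixed_field).
Proof. by rewrite inE; apply: eqP. Qed.

(** The element 1 works unless the characteristic is 2; then any element moved by [sigma] does. *)
Lemma exists_trace_neq0 : exists a, a + sigma a != 0.
Proof.
have [_ _ _ [x sx] _] := fP.
have [e1|n1] := eqVneq (1 + sigma 1) 0; last by exists 1.
exists x; apply: contra sx; rewrite addr_eq0 => /eqP xs.
move: e1; rewrite rmorph1 => /eqP; rewrite addr_eq0 => /eqP m1.
by rewrite -[sigma x]mul1r m1 mulN1r -xs.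
Qed.

(* F is two-dimensional over the fixed field, with basis 1, t for any t moved by sigma. *)
Lemma card_fixed_field : (#|fixed_field| * #|fixed_field|)%N = q.
Proof.
have [_ _ ss [t st] _] := fP.
have t0 : t - sigma t != 0 by rewrite subr_eq0 eq_sym.
rewrite -cardsX -cardsT -(card_in_imset (f := fun p : F * F => p.1 + p.2 * t)).
  apply: eq_card => x; rewrite [RHS]inE; apply/imsetP.
  (* Solves x = a + b t together with its conjugate sigma x = a + b sigma t. *)
  pose b := (x - sigma x) / (t - sigma t).
  have sb : sigma b = b.
    rewrite /b fmorph_div !rmorphB /= !ss -[sigma x - x]opprB -[sigma t - t]opprB.
    by rewrite invrN mulrNN.
  have bt : b * t - b * sigma t = x - sigma x by rewrite -mulrBr divfK.
  exists (x - b * t, b); last by rewrite /= subrK.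
  have sx : sigma x = x - (b * t - b * sigma t) by rewrite bt subKr.
  rewrite !inE /= sb eqxx andbT rmorphB rmorphM /= sb sx; apply/eqP; ring.
move=> [a b] [a' b'] /setXP[/= /fixedP sa /fixedP sb] /setXP[/= /fixedP sa' /fixedP sb'] e.
have e' : a + b * sigma t = a' + b' * sigma t.
  by move/(congr1 sigma): e; rewrite !rmorphD !rmorphM /= sa sb sa' sb'.
have /eqP : (b - b') * (t - sigma t) = 0.
  have -> : (b - b') * (t - sigma t) =
    (a + b * t - (a + b * sigma t)) - (a' + b' * t - (a' + b' * sigma t)) by ring.
  by rewrite e e' subrr.
rewrite mulf_eq0 (negPf t0) orbF subr_eq0 => /eqP bb.
by move: e; rewrite bb => /addIr ->.
Qed.

Lemma fixed_field_gt0 : (0 < #|fixed_field|)%N.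
Proof. by apply/card_gt0P; exists 0; rewrite inE rmorph0. Qed.

Lemma hermitian_axioms : polar_axioms f [pred v | f v v == 0] #|fixed_field|.
Proof.
have [[linl linr] sym ss _ nondeg] := fP.
have fD u v w : f (u + v) w = f u w + f v w by rewrite -{1}[u]scale1r linl mul1r.
have fDr u v w : f w (u + v) = f w u + f w v.
  by rewrite -{1}[u]scale1r linr rmorph1 mul1r.
have refl u v : f u v = 0 -> f v u = 0 by move=> uv; rewrite sym uv rmorph0.
have f0 w : f 0 w = 0 by apply: (addrI (f 0 w)); rewrite -fD !addr0.
have f0r w : f w 0 = 0 by apply: refl.
have fZ a u w : f (a *: u) w = a * f u w by rewrite -[_ *: _]addr0 linl f0 addr0.
have fZr a u w : f w (a *: u) = sigma a * f w u by rewrite -[_ *: _]addr0 linr f0r addr0.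
split=> //=.
- by rewrite f0.
- by move=> a v /eqP vv; rewrite fZ fZr vv !mulr0.
- by move=> u v /eqP uu /eqP vv uv; rewrite fD !fDr uu vv uv (refl u v uv) !addr0.
- by move=> u /eqP.
- by move=> v _ h; apply: nondeg => w; apply: refl.
move=> T v u tiT uT uv; have [sT isoT _] := tiP _ _ _ tiT.
(* For t in T, f (v + t) (v + t) = f v v + [phi t], where [phi] is the trace of f v t and maps T
   onto the fixed field. *)
pose phi t := f v t + sigma (f v t).
have vu : f v u != 0 by apply: contra uv => /eqP/refl ->.
rewrite -(@card_fiber _ _ phi T fixed_field (- f v v) sT).
- congr (_ * _)%N; apply: eq_card => t; rewrite !inE; case tT: (t \in T) => //=.
  have /eqP tt := isoT t tT.
  by rewrite /phi fD !fDr tt addr0 -sym -addrA addrC addr_eq0.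
- by move=> x y; rewrite /phi fDr rmorphD /= addrACA.
- by move=> t _; rewrite inE /phi rmorphD /= ss addrC.
- move=> b /fixedP sb; have [a0 tr0] := exists_trace_neq0.
  have str : sigma (a0 + sigma a0) = a0 + sigma a0 by rewrite rmorphD /= ss addrC.
  set tr := a0 + _ in tr0 str.
  (* The scalar makes f v take the value b / tr * a0, whose trace is b since b / tr is fixed. *)
  exists (sigma (b / tr * a0 / f v u) *: u); first exact: subspaceZ.
  rewrite /phi fZr ss divfK // rmorphM fmorph_div /= sb str -mulrDr -/tr divfK //.
- by rewrite inE rmorphN -sym.
Qed.

Lemma hermitian_tot_iso T :
  tot_iso Defs.Hermitian f Q T = tot_iso_for f [pred v | f v v == 0] T.
Proof.
rewrite /tot_iso /tot_iso_for /=; case: (boolP (is_subspace T)) => //= sT.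
apply/idP/andP=> [fT|[] //]; split=> //; apply/forall_inP=> u uT /=.
by move/forall_inP/(_ u uT)/forall_inP/(_ u uT): fT.
Qed.
End Hermitian.
End Instances.

(** * The closed formula in terms of the real parameter e *)

Section Bound.
Variables (F : finFieldType) (n : nat) (k : polar_kind).
Local Notation V := 'rV[F]_n.
Local Notation q := #|F|.
Variables (f : V -> V -> F) (Q : V -> F) (g : V -> V -> F) (iso : pred V) (q0 : nat).
Hypothesis gP : polar_axioms g iso q0.
Hypothesis tot_isoE : forall T, tot_iso k f Q T = tot_iso_for g iso T.
Local Notation d := (witt_index k f Q).
Hypotheses (d_gt0 : (0 < d)%N) (q0_gt0 : (0 < q0)%N).

Lemma metric_dim_bounds (e : R) :
  Rpower (INR q) (e - 1) = polar_eps k f Q q0 ->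
  (metric_dim (dual_polar_adj k f Q) <= \rank (incidence_matrix k f Q))%N /\
  Rle (INR (metric_dim (dual_polar_adj k f Q))) (polar_bound q d e).
Proof.
move=> eE; have le := metric_dim_leq_rank gP tot_isoE d_gt0; split=> //.
apply/RleP; rewrite INRE.
apply: (@le_trans _ _ (\rank (incidence_matrix k f Q))%:R); first by rewrite ler_nat.
apply: le_trans (rank_incidence_le gP tot_isoE d_gt0 q0_gt0) _.
have qpos : Rlt 0 (INR q) by apply/RltP; rewrite INRE; apply: lt_trans ltr01 (qR_gt1 F).
have powE : Rpower (INR q) (INR d + e - 1) = qR F * hyp_card k f Q * polar_eps k f Q q0.
  rewrite /Rminus Rplus_assoc Rpower_plus -/(Rminus e 1) [Rpower _ (_ - _)]eE.
  by rewrite Rpower_pow // RpowE INRE -/(qR F) hyp_card_exp.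
rewrite /polar_bound RdivE powE [Rpower _ (e - 1)]eE INRE.
exact: lexx.
Qed.
End Bound.

(** All q^n vectors are isotropic and q0 = 1, so the count of isotropic vectors reduces to q^(n-d) =
    q^d. *)
Lemma symplectic_dim (F : finFieldType) (n : nat) (f : 'rV[F]_n -> 'rV[F]_n -> F)
    (Q : 'rV[F]_n -> F) :
  symplectic_form f -> (n - 2 * witt_index Symplectic f Q)%N = 0.
Proof.
move=> fP; have gP := symplectic_axioms fP; have tE := symplectic_tot_iso f Q.
have exW := gen_ex_witt gP tE.
have := card_iso_all gP (ti_max_witt tE) exW; have := double_witt_leq gP exW.
have -> : iso_in predT [set: 'rV[F]_n] = [set: _] by apply/setP=> v; rewrite !inE.
set d := witt_index _ _ _; rewrite card_V !mul1n addnC => le /addIn /eqP.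
by rewrite eqn_exp2l ?card_scalars_gt1 // => /eqP; lia.
Qed.

Lemma INR_card_gt0 (F : finFieldType) : Rlt 0 (INR #|F|).
Proof. by apply/RltP; rewrite INRE; apply: lt_trans ltr01 (qR_gt1 F). Qed.

Lemma Rpower_natr (F : finFieldType) (m : nat) : Rpower (INR #|F|) (INR m) = qR F ^+ m.
Proof.
by rewrite (Rpower_pow _ _ (INR_card_gt0 F)) RpowE INRE.
Qed.

Theorem theorem2p3 (F : finFieldType) (n : nat) (k : polar_kind)
  (sigma : {rmorphism F -> F}) (f : 'rV[F]_n -> 'rV[F]_n -> F) (Q : 'rV[F]_n -> F) :
  classical_form k sigma f Q ->
  (1 <= witt_index k f Q)%N ->
  (metric_dim (dual_polar_adj k f Q) <= \rank (incidence_matrix k f Q))%N /\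
  Rle (INR (metric_dim (dual_polar_adj k f Q)))
      (polar_bound #|F| (witt_index k f Q) (polar_e n k (witt_index k f Q))).
Proof.
have qpos := INR_card_gt0 F.
case: k => /= formP d_gt0.
- apply: (metric_dim_bounds (symplectic_axioms formP) (symplectic_tot_iso f Q)) => //.
  by rewrite /polar_eps symplectic_dim // expr0 divr1 RminusE subrr Rpower_O.
- apply: (metric_dim_bounds (quadratic_axioms formP) (quadratic_tot_iso f Q)) => //.
    exact: ltnW (card_scalars_gt1 F).
  by rewrite /Rminus Rpower_plus Rpower_natr Rpower_Ropp Rpower_1 // INRE.
- apply: (metric_dim_bounds (hermitian_axioms formP) (hermitian_tot_iso f Q)) => //.
    exact: fixed_field_gt0.
  have -> : forall x : R, Rminus (Rplus x (Rinv (IZR 2))) (IZR 1) = Rplus x (Ropp (Rinv (IZR 2))).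
    by move=> x; Lra.lra.
  (* Here e - 1 = (n - 2d) - 1/2, and the square root of q is the order of the fixed field, which is
     q0. *)
  rewrite Rpower_plus Rpower_natr Rpower_Ropp Rpower_sqrt // -(card_fixed_field formP).
  by rewrite mult_INR (sqrt_square _ (pos_INR _)) /polar_eps INRE.
Qed.
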